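(* Let $\ell \in \{1,2,\dots\}$, $a_1,\dotsc,a_\ell \in V\setminus\{0\}$ and $b_1,\dotsc,b_\ell \in \mathbf{R}^n\setminus\{0\}$. The following are equivalent: (i) there exists $C>0$ such that for every $u \in C^\infty_c(\mathbf{R}^n;V)$, $$\int_{\mathbf{R}^n} \frac{|u(x)|}{|x|}\,dx \le C\sum_{i=1}^\ell \int_{\mathbf{R}^n} |a_i\cdot Du(x)[b_i]|\,dx;$$ (ii) for every $\xi \in \mathbf{R}^n\setminus\{0\}$ and $v \in V\setminus\{0\}$ there exists $i \in \{1,\dotsc,\ell\}$ such that $a_i\cdot v \ne 0$ and $|b_i|^2\xi \ne (\xi\cdot b_i)b_i$.
   Context: $V$ is a real finite-dimensional vector space endowed with an inner product denoted by $\cdot$, and the same symbol denotes the Euclidean inner product on $\mathbf{R}^n$. $Du(x)[b]\in V$ denotes the derivative of $u$ at $x$ in the direction $b$. *)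

(* Defs.v *)
From HB Require Import structures.
From mathcomp Require Import all_boot all_order all_algebra.
From mathcomp Require Import all_classical all_reals all_analysis.

Set Implicit Arguments.
Unset Strict Implicit.
Unset Printing Implicit Defensive.

Import Order.TTheory GRing.Theory Num.Theory.
Import numFieldNormedType.Exports.

Local Open Scope classical_set_scope.
Local Open Scope ring_scope.

#[short(type="normedVectType")]
HB.structure Definition NormedVector (R : numDomainType) :=
  {V of Vector R V & NormedModule R V}.

(* The library norm on 'rV[R]_n is the sup norm; it induces the usual topology,
   but the Euclidean length has to be introduced separately. *)
Definition edot (R : realType) (n : nat) (x y : 'rV[R]_n) : R :=
  \sum_(i < n) x 0 i * y 0 i.

Definition enorm (R : realType) (n : nat) (x : 'rV[R]_n) : R :=
  Num.sqrt (edot x x).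

(* C^k maps: directional derivatives are taken along every vector b, which is
   the same as taking partial derivatives once they are required to be
   continuous. *)
Fixpoint Ck (R : realType) (n : nat) (V : normedModType R) (k : nat)
    (u : 'rV[R]_n -> V) : Prop :=
  if k is k'.+1 then
    continuous u /\
    forall b, (forall x, derivable u x b) /\ Ck k' (fun x => 'D_b u x)
  else continuous u.

Definition smooth_compact_support (R : realType) (n : nat)
    (V : normedModType R) (u : 'rV[R]_n -> V) : Prop :=
  (forall k, Ck k u) /\ compact (closure [set x | u x != 0]).

Section cons_measure.
Context (R : realType) (n : nat).
Variable mu : {sigma_finite_measure set (n.-tuple (measurableTypeR R)) -> \bar R}.

Definition cons_pair (p : measurableTypeR R * n.-tuple (measurableTypeR R)) :
  n.+1.-tuple (measurableTypeR R) := [tuple of p.1 :: p.2].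

Lemma measurable_cons_pair : measurable_fun setT cons_pair.
Proof.
by apply: (measurable_cons (f := fst) (g := snd)) => //; exact: measurable_snd.
Qed.

Definition cons_measure : set (n.+1.-tuple (measurableTypeR R)) -> \bar R :=
  pushforward (lebesgue_measure \x mu)%E cons_pair.

Let cons_measure_pre A : measurable A -> measurable (cons_pair @^-1` A).
Proof.
by move=> mA; rewrite -[X in measurable X]setTI; exact: measurable_cons_pair.
Qed.

Let cons_measure0 : cons_measure set0 = 0%E.
Proof. by rewrite /cons_measure /pushforward preimage_set0 measure0. Qed.

Let cons_measure_ge0 A : (0 <= cons_measure A)%E.
Proof. exact: (measure_ge0 (lebesgue_measure \x mu)%E). Qed.

Let cons_measure_sigma_additive : semi_sigma_additive cons_measure.
Proof.
move=> F mF tF mUF; rewrite /cons_measure /pushforward preimage_bigcup.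
apply: measure_semi_sigma_additive.
- by move=> k; exact: cons_measure_pre.
- apply/trivIsetP => /= i j _ _ ij; rewrite -preimage_setI.
  by move/trivIsetP : tF => /(_ _ _ _ _ ij) ->//; rewrite preimage_set0.
- by rewrite -preimage_bigcup; exact: cons_measure_pre.
Qed.

HB.instance Definition _ := isMeasure.Build _ _ _
  cons_measure cons_measure0 cons_measure_ge0 cons_measure_sigma_additive.

Let cons_measure_sigma_finite : sigma_finite setT cons_measure.
Proof.
pose leb : {sigma_finite_measure set (measurableTypeR R) -> \bar R} :=
  lebesgue_measure.
have /sigma_finiteP[F [TF ndF Foo]] := sigma_finiteT leb.
have /sigma_finiteP[G [TG ndG Goo]] := sigma_finiteT mu.
pose split_tuple (t : n.+1.-tuple (measurableTypeR R)) :
  measurableTypeR R * n.-tuple (measurableTypeR R) :=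
  (thead t, [tuple of behead t]).
have msplit : measurable_fun setT split_tuple.
  by apply/measurable_fun_pair; [exact: measurable_tnth|exact: measurable_behead].
have splitK p : split_tuple (cons_pair p) = p.
  by case: p => x t; congr pair; apply/val_inj.
exists (fun k => split_tuple @^-1` (F k `*` G k)).
  rewrite -preimage_bigcup (_ : \bigcup_k _ = setT) ?preimage_setT//.
  rewrite -setXTT TF TG predeqE => -[x y]; split=> [[k _ []/= ? ?]|].
    by split; exists k.
  move=> [/= [i _ Fx] [k _ Gy]]; exists (maxn i k) => //; split.
  - by move: x Fx; exact/subsetPset/ndF/leq_maxl.
  - by move: y Gy; exact/subsetPset/ndG/leq_maxr.
move=> k; have [mF Fk] := Foo k; have [mG Gk] := Goo k; split.
  by rewrite -[X in measurable X]setTI; apply: msplit => //; exact: measurableX.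
rewrite /cons_measure /pushforward -comp_preimage.
rewrite (_ : split_tuple \o cons_pair = id); last exact/funext.
by rewrite preimage_id product_measure1E// lte_mul_pinfty// ge0_fin_numE.
Qed.

HB.instance Definition _ := Measure_isSigmaFinite.Build _ _ _
  cons_measure cons_measure_sigma_finite.

End cons_measure.

(* The n-fold product of the one-dimensional Lebesgue measure, R^n being
   represented by n.-tuple R with its product sigma-algebra. For n = 0 this is
   the unit mass on the one-point space. *)
Fixpoint lebesgue_measure_tuple (R : realType) (n : nat) :
    {sigma_finite_measure set (n.-tuple (measurableTypeR R)) -> \bar R} :=
  if n is m.+1 then cons_measure (lebesgue_measure_tuple R m)
  else \d_([tuple] : 0.-tuple (measurableTypeR R)).

(* Lebesgue integral over R^n, through the identification of row vectors with
   tuples. The value is an extended real; it is only used for nonnegative f. *)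
Definition integral_rV (R : realType) (n : nat) (f : 'rV[R]_n -> R) : \bar R :=
  (\int[lebesgue_measure_tuple R n]_t (f (\row_(i < n) tnth t i))%:E)%E.

(* Main.v *)
Require Import Defs.
From HB Require Import structures.
From mathcomp Require Import all_boot all_order all_algebra.
From mathcomp Require Import all_classical all_reals all_analysis.
From mathcomp Require Import measurable_realfun ring lra.

Set Implicit Arguments.
Unset Strict Implicit.
Unset Printing Implicit Defensive.

Import Order.TTheory GRing.Theory Num.Theory.
Import numFieldNormedType.Exports.

Local Open Scope classical_set_scope.
Local Open Scope ring_scope.

(** Let [rho_b x] be the square root of the Gram determinant of [x] and [b]. It
vanishes exactly when [x] is parallel to [b], so the algebraic condition says
that the sum of [`|a_i . v| * rho_(b_i) x] over [i] vanishes for no nonzero [x]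
and [v]. By homogeneity and compactness of the unit spheres this sum is then at
least [c * `|x| * `|v|] for some [c > 0] (lemma [coercive]).

If the condition holds, it follows that [`|u x| / `|x|] is at most [c^-1] times
the sum of the [poisson (b_i) x * `|a_i . u x|], where [poisson b x] is
[rho_b x / `|x|^2]. On every line parallel to [b] the weight [poisson b] is
zero or the derivative of an arctangent, so its integral is at most [pi], although
[1 / `|x|] itself is not integrable on lines. Now [`|a_i . u x|] is at most the integral of
[`|a_i . D u [b_i]|] along the half-line from [x] in the direction [b_i]; Tonelli's
theorem and translation invariance transfer this integration to the weight
([integral_poisson_derive]) and give the Hardy inequality. No change of variables
other than translations is involved, so [b_i] need not be a coordinate vector.

If the condition fails at [xi] and [v], every [b_i] with [a_i . v != 0] is parallel
to [xi]. For [u = phi v] the right-hand side then only sees the derivative of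
[phi] along [xi]. Take for [phi] a bump on a cylinder around the line spanned by
[xi], stretched [N] times along this line ([plateau]): the derivative has size
[1 / N] on a set of volume of order [N], so the right-hand side stays bounded, but
the integral of [phi / `|x|] grows at least like the harmonic series of length [N]. Both
facts are obtained by cutting the cylinder into translates of a single cell
([dbump_le_cells] and [cells_le_plateau]). *)

(** * Lebesgue measure on tuples *)

Definition tuple_rV (R : realType) (n : nat)
  (t : n.-tuple (measurableTypeR R)) : 'rV[R]_n := \row_(i < n) tnth t i.

Definition shift_tuple (R : realType) (n : nat) (c : 'rV[R]_n)
    (t : n.-tuple (measurableTypeR R)) : n.-tuple (measurableTypeR R) :=
  [tuple tnth t i + c 0 i | i < n].

Definition measurable_rV (R : realType) (n : nat) (f : 'rV[R]_n -> R) :=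
  measurable_fun setT (fun t => f (tuple_rV t)).

Section tuple_measure.
Context {R : realType}.
Local Notation mT := (measurableTypeR R).
Local Notation leb := (@lebesgue_measure R).

Lemma tuple_rV_shift n (c : 'rV[R]_n) t :
  tuple_rV (shift_tuple c t) = tuple_rV t + c.
Proof. by apply/rowP => i; rewrite !mxE tnth_mktuple. Qed.

Lemma measurable_shift_tuple n (c : 'rV[R]_n) :
  measurable_fun setT (shift_tuple c).
Proof.
apply/measurable_fun_tnthP => i.
rewrite (_ : _ \o _ = fun t => tnth t i + c 0 i); last first.
  by apply/funext => t /=; rewrite tnth_mktuple.
by apply: measurable_funD => //; exact: measurable_tnth.
Qed.

Lemma lebesgue_measure_shift (c : R) (A : set R) : measurable A ->
  pushforward leb (fun x : mT => x + c : mT) A = leb A.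
Proof.
have mc : measurable_fun setT ((fun x => x + c) : mT -> mT).
  by apply: measurable_funD.
move=> mA; pose f : {mfun mT >-> mT} := HB.pack (fun x : mT => x + c : mT)
  (isMeasurableFun.Build _ _ _ _ _ mc).
apply/esym/(@lebesgue_measure_unique R (pushforward leb f)) => //= _ [[a b]] _ <-.
rewrite /pushforward (_ : _ @^-1` _ = `]a - c, b - c]%classic); last first.
  by apply/seteqP; split => x /=; rewrite !in_itv/= ltrBlDr lerBrDr.
rewrite !lebesgue_measure_itv/= !lte_fin ltrD2r.
by case: ifP => // _; rewrite -!EFinB; congr EFin; ring.
Qed.

Lemma ge0_integral_shift (c : R) (f : mT -> \bar R) :
  measurable_fun setT f -> (forall x, 0 <= f x)%E ->
  (\int[leb]_x f (x + c)%R = \int[leb]_x f x)%E.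
Proof.
move=> mf f0.
have mc : measurable_fun setT ((fun x => x + c) : mT -> mT).
  by apply: measurable_funD.
rewrite [RHS](eq_measure_integral (pushforward leb (fun x : mT => x + c : mT)))/=; last first.
  by move=> A mA _; exact/esym/lebesgue_measure_shift.
by rewrite ge0_integral_pushforward.
Qed.

Lemma ge0_integral_tuple_cons n (f : n.+1.-tuple mT -> \bar R) :
  measurable_fun setT f -> (forall t, 0 <= f t)%E ->
  (\int[lebesgue_measure_tuple R n.+1]_t f t =
   \int[leb]_x \int[lebesgue_measure_tuple R n]_t f [tuple of x :: t])%E.
Proof.
move=> mf f0.
rewrite [LHS](ge0_integral_pushforward (@measurable_cons_pair R n))//.
rewrite fubini_tonelli1//.
  by apply: measurableT_comp => //; exact: measurable_cons_pair.
by move=> x; exact: f0.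
Qed.

Lemma shift_tuple_cons n (c : 'rV[R]_n.+1) x (t : n.-tuple mT) :
  shift_tuple c [tuple of x :: t] =
  [tuple of x + c 0 0 :: shift_tuple (\row_i c 0 (lift ord0 i)) t].
Proof.
apply: eq_from_tnth => i; rewrite tnth_mktuple.
have [j ->|->] := unliftP ord0 i; last by rewrite !tnth0.
by rewrite !tnthS tnth_mktuple mxE.
Qed.

(** By induction on the number of coordinates: Tonelli's theorem reduces a
translation to one coordinate at a time. *)
Lemma ge0_integral_shift_tuple n (c : 'rV[R]_n) (f : n.-tuple mT -> \bar R) :
  measurable_fun setT f -> (forall t, 0 <= f t)%E ->
  (\int[lebesgue_measure_tuple R n]_t f (shift_tuple c t) =
   \int[lebesgue_measure_tuple R n]_t f t)%E.
Proof.
elim: n c f => [|n IH] c f mf f0.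
  by congr integral; apply/funext => t; congr f; rewrite (tuple0 t) tuple0.
have mfc x : measurable_fun setT (fun t : n.-tuple mT => f [tuple of x :: t]).
  by apply: measurableT_comp => //; exact: measurable_cons.
rewrite ge0_integral_tuple_cons//; last first.
  by apply: measurableT_comp => //; exact: measurable_shift_tuple.
under eq_integral => x _.
  under eq_integral do rewrite shift_tuple_cons.
  rewrite (IH _ (fun t => f [tuple of x + c 0 0 :: t]))//.
  over.
rewrite ge0_integral_tuple_cons//.
apply: (ge0_integral_shift _
  (f := fun x => \int[lebesgue_measure_tuple R n]_t f [tuple of x :: t])%E).
- apply: (measurable_fun_fubini_tonelli_F
    (fun p : mT * n.-tuple mT => f [tuple of p.1 :: p.2])) => //.
  by apply: measurableT_comp => //; exact: measurable_cons_pair.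
- by move=> x; exact: integral_ge0.
Qed.

Definition box_tuple n (q : 'rV[R]_n) (r : R) : set (n.-tuple mT) :=
  [set t | forall i, `|tnth t i - q 0 i| < r].

Lemma measurable_box_tuple n (q : 'rV[R]_n) (r : R) : measurable (box_tuple q r).
Proof.
rewrite (_ : box_tuple q r =
    \bigcap_(i in [set: 'I_n]) ((fun t => tnth t i) @^-1` (ball (q 0 i) r))).
  apply: fin_bigcap_measurable; first exact: finite_finset.
  move=> i _; rewrite -[X in measurable X]setTI.
  by apply: measurable_tnth => //; exact: measurable_ball.
apply/seteqP; split => t /= qt i; last by rewrite distrC; exact: qt.
by move=> _; rewrite /= /ball/= distrC.
Qed.

Lemma lebesgue_measure_box_tuple n (q : 'rV[R]_n) (r : R) : 0 <= r ->
  lebesgue_measure_tuple R n (box_tuple q r) = ((r *+ 2) ^+ n)%:E.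
Proof.
move=> r0; elim: n q => [|n IH] q.
  by rewrite /= expr0 diracE mem_set// => -[].
rewrite /= /cons_measure /pushforward.
rewrite (_ : _ @^-1` _ =
  ball (q 0 0) r `*` box_tuple (\row_i q 0 (lift ord0 i)) r); last first.
  apply/seteqP; split => -[x t]; rewrite /box_tuple /cons_pair/=.
    move=> xt; split => [|i].
      by have := xt ord0; rewrite tnth0 /ball/= distrC.
    by have := xt (lift ord0 i); rewrite tnthS mxE.
  move=> [x_q tq] i; have [j ->|->] := unliftP ord0 i.
    by rewrite tnthS; have := tq j; rewrite mxE.
  by rewrite tnth0 distrC.
rewrite product_measure1E//; first last.
- exact: measurable_box_tuple.
- exact: measurable_ball.
by rewrite [X in (X * _)%E](lebesgue_measure_ball (q 0 0) r0) [X in (_ * X)%E]IH -EFinM exprS.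
Qed.

(** The sigma-algebra is generated by the coordinates, and not by the topology of
row vectors; the two are compatible because an open set is the union of the
rational boxes that it contains. *)
Lemma continuous_measurable_rV n (f : 'rV[R]_n -> R) :
  continuous f -> measurable_rV f.
Proof.
move=> cf; apply: (measurability _ (RGenOInfty.measurableE R)) => //.
move=> /= _ [_ [a ->] <-]; rewrite setTI preimage_itvoy/=.
pose box (p : 'rV[rat]_n * nat) := box_tuple (map_mx ratr p.1) p.2.+1%:R^-1.
rewrite (_ : [set _ | _] = \bigcup_p
    (if `[< forall t, box p t -> a < f (tuple_rV t) >] then box p else set0)).
  apply: countable_bigcupT_measurable => [|p]; first exact: countableP.
  by case: ifP => // _; exact: measurable_box_tuple.
apply/seteqP; split => t /=; last first.
  by move=> [p _]; case: ifPn => // /asboolP pf /pf.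
move=> aft.
have /nbhs_ballP[e /= e0 eaf] : nbhs (tuple_rV t) [set x | a < f x].
  by have := cf (tuple_rV t); move/cvgr_gt; exact.
have [k ke] : exists k, k.+1%:R^-1 *+ 2 < e.
  have [k _ ke] := near_infty_natSinv_lt (PosNum (divr_gt0 e0 (ltr0n R 2))).
  by exists k; have := ke k (leqnn k); rewrite /= ltr_pdivlMr// mulr_natr.
have k0 : 0 < k.+1%:R^-1 :> R by rewrite invr_gt0.
move: k0 ke @box => + + box; set d := (X in 0 < X) => k0 ke.
have /choice[q tq] i : exists q : rat, `|tnth t i - ratr q| < d.
  pose x : R := tnth t i.
  have [|q] := @rat_in_itvoo R (x - d) (x + d); first by lra.
  rewrite in_itv/= => /andP[? ?]; exists q; rewrite -/x ltr_norml.
  by apply/andP; split; lra.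
exists (\row_i q i, k) => //; rewrite asboolT; last first.
  move=> t' tt'; apply: eaf; split => // i j; rewrite !mxE.
  have := tt' j; have := tq j; rewrite /= !mxE /ball/= => tqj qt'j.
  rewrite (le_lt_trans (ler_distD (ratr (q j)) _ _))// (lt_trans _ ke)//.
  by rewrite mulr2n ltrD// distrC.
by move=> i; rewrite !mxE.
Qed.

End tuple_measure.

(** * Integration over row vectors *)
Section integral_rV_theory.
Context {R : realType} {n : nat}.
Local Notation mT := (measurableTypeR R).
Local Notation mu := (lebesgue_measure_tuple R n).
Implicit Types (d : 'rV[R]_n) (f g : 'rV[R]_n -> R).

Lemma le_integral_rV f g : measurable_rV f -> measurable_rV g ->
  (forall x, 0 <= f x) -> (forall x, f x <= g x) ->
  (integral_rV f <= integral_rV g)%E.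
Proof.
move=> mf mg f0 fg; apply: ge0_le_integral => //.
- by move=> x _; rewrite lee_fin.
- exact/measurable_EFinP.
- exact/measurable_EFinP.
- by move=> x _; rewrite lee_fin.
Qed.

Lemma integral_rVZl (c : R) f : measurable_rV f -> (forall x, 0 <= f x) ->
  0 <= c -> integral_rV (fun x => c * f x) = (c%:E * integral_rV f)%E.
Proof.
move=> mf f0 c0; rewrite /integral_rV; under eq_integral do rewrite EFinM.
rewrite ge0_integralZl//; first exact/measurable_EFinP.
by move=> x _; rewrite lee_fin.
Qed.

Lemma integral_rV_sum (I : Type) (s : seq I) (f : I -> 'rV[R]_n -> R) :
  (forall i, measurable_rV (f i)) -> (forall i x, 0 <= f i x) ->
  integral_rV (fun x => \sum_(i <- s) f i x) =
  (\sum_(i <- s) integral_rV (f i))%E.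
Proof.
move=> mf f0; rewrite /integral_rV; under eq_integral do rewrite -sumEFin.
rewrite ge0_integral_sum//.
- by move=> i; apply/measurable_EFinP; exact: mf.
- by move=> i x _; rewrite lee_fin.
Qed.

Lemma measurable_rV_sum (I : Type) (s : seq I) (f : I -> 'rV[R]_n -> R) :
  (forall i, measurable_rV (f i)) ->
  measurable_rV (fun x => \sum_(i <- s) f i x).
Proof.
move=> mf; rewrite /measurable_rV.
exact: (measurable_sum s (h := fun i t => f i (tuple_rV t))).
Qed.

Lemma measurable_rV_inv f : measurable_rV f -> (forall x, 0 <= f x) ->
  measurable_rV (fun x => (f x)^-1).
Proof.
move=> mf f0; rewrite /measurable_rV.
under eq_fun do rewrite -powR_inv1//.
exact: (@measurableT_comp _ _ _ _ _ _ (@powR R ^~ (-1))).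
Qed.

Lemma integral_rV_ge0 f : (forall x, 0 <= f x) -> (0 <= integral_rV f)%E.
Proof. by move=> f0; apply: integral_ge0 => t _; rewrite lee_fin. Qed.

Lemma integral_rV_shift f d :
  measurable_rV f -> (forall x, 0 <= f x) ->
  integral_rV (fun x => f (x + d)) = integral_rV f.
Proof.
move=> mf f0; rewrite /integral_rV.
under eq_integral => t _ do rewrite -[\row__ _]/(tuple_rV t) -tuple_rV_shift.
apply: (ge0_integral_shift_tuple d (f := fun z => (f (tuple_rV z))%:E)).
  exact/measurable_EFinP.
by move=> x; rewrite lee_fin.
Qed.

Lemma measurable_rV_shift f d :
  measurable_rV f -> measurable_rV (fun x => f (x + d)).
Proof.
move=> mf; rewrite /measurable_rV.
rewrite (_ : (fun _ => _) = (fun z => f (tuple_rV z)) \o shift_tuple d).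
  by apply: measurableT_comp => //; exact: measurable_shift_tuple.
by apply/funext => z /=; rewrite tuple_rV_shift.
Qed.

Lemma measurable_rV_line g d : measurable_rV g ->
  measurable_fun setT
    (fun p : n.-tuple mT * mT => g (tuple_rV p.1 + (p.2 : R) *: d)).
Proof.
move=> mg; pose sh (p : n.-tuple mT * mT) := shift_tuple ((p.2 : R) *: d) p.1.
rewrite (_ : (fun p => _) = (fun t => g (tuple_rV t)) \o sh); last first.
  by apply/funext => p; rewrite /= /sh tuple_rV_shift.
apply: measurableT_comp => //; apply/measurable_fun_tnthP => i.
rewrite (_ : _ \o _ = fun p => tnth p.1 i + p.2 * d 0 i); last first.
  by apply/funext => p; rewrite /= tnth_mktuple mxE.
apply: measurable_funD.
  apply: (@measurableT_comp _ _ _ _ _ _ (fun t : n.-tuple mT => tnth t i)) => //.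
  exact: measurable_tnth.
by apply: measurable_funM.
Qed.

End integral_rV_theory.

(** * Euclidean geometry and the Poisson kernel *)
Section euclidean.
Context {R : realType} {n : nat}.
Implicit Types x y b : 'rV[R]_n.

Lemma edotC x y : edot x y = edot y x.
Proof. by apply: eq_bigr => i _; rewrite mulrC. Qed.

Lemma edotDl x y b : edot (x + y) b = edot x b + edot y b.
Proof. by rewrite -big_split; apply: eq_bigr => i _; rewrite mxE mulrDl. Qed.

Lemma edotZl (c : R) x b : edot (c *: x) b = c * edot x b.
Proof. by rewrite mulr_sumr; apply: eq_bigr => i _; rewrite mxE mulrA. Qed.

Lemma edotDr x y b : edot b (x + y) = edot b x + edot b y.
Proof. by rewrite edotC edotDl !(edotC b). Qed.

Lemma edotZr (c : R) x b : edot b (c *: x) = c * edot b x.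
Proof. by rewrite edotC edotZl (edotC b). Qed.

Lemma edot0r x : edot x 0 = 0.
Proof. by rewrite /edot big1// => i _; rewrite mxE mulr0. Qed.

Lemma edot_ge0 x : 0 <= edot x x.
Proof. by apply: sumr_ge0 => i _; rewrite -expr2 sqr_ge0. Qed.

Lemma edot_eq0 x : (edot x x == 0) = (x == 0).
Proof.
apply/idP/eqP => [|->]; last by rewrite edot0r.
rewrite psumr_eq0 => [/allP x0|i _]; last by rewrite -expr2 sqr_ge0.
apply/rowP => i; rewrite mxE; apply/eqP.
by have /implyP/(_ isT) := x0 i (mem_index_enum _); rewrite mulf_eq0 orbb.
Qed.

Lemma edot_gt0 x : (0 < edot x x) = (x != 0).
Proof. by rewrite lt_def edot_ge0 andbT edot_eq0. Qed.

Lemma sqr_enorm x : enorm x ^+ 2 = edot x x.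
Proof. by rewrite sqr_sqrtr// edot_ge0. Qed.

Lemma enorm_ge0 x : 0 <= enorm x.
Proof. exact: sqrtr_ge0. Qed.

Lemma enorm_eq0 x : (enorm x == 0) = (x == 0).
Proof. by rewrite sqrtr_eq0 le_eqVlt ltNge edot_ge0 orbF edot_eq0. Qed.

Lemma enorm_gt0 x : (0 < enorm x) = (x != 0).
Proof. by rewrite lt_def enorm_ge0 andbT enorm_eq0. Qed.

Lemma enormZ (c : R) x : enorm (c *: x) = `|c| * enorm x.
Proof.
by rewrite /enorm edotZl edotZr mulrA -expr2 sqrtrM ?sqr_ge0// sqrtr_sqr.
Qed.

Lemma edot_delta x i : edot x (delta_mx 0 i) = x 0 i.
Proof.
rewrite /edot (bigD1 i)//= big1 ?addr0 => [|j ji]; first by rewrite mxE !eqxx mulr1.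
by rewrite mxE (negPf ji) andbF mulr0.
Qed.

Lemma coord_le_enorm x i : `|x 0 i| <= enorm x.
Proof.
rewrite /enorm -sqrtr_sqr ler_wsqrtr// /edot (bigD1 i)//= expr2 lerDl.
by apply: sumr_ge0 => k _; rewrite -expr2 sqr_ge0.
Qed.

Lemma enorm_le_coord x (r : R) : 0 <= r -> (forall i, `|x 0 i| <= r) ->
  enorm x <= n%:R * r.
Proof.
move=> r0 xr; rewrite /enorm -(ger0_norm (_ : 0 <= n%:R * r)) ?mulr_ge0//.
rewrite -sqrtr_sqr ler_wsqrtr//.
apply: (@le_trans _ _ (\sum_(i < n) r ^+ 2)).
  apply: ler_sum => i _; rewrite -expr2 -real_normK ?num_real//.
  by rewrite lerXn2r ?nnegrE.
rewrite sumr_const card_ord -[leLHS]mulr_natl exprMn.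
rewrite ler_wpM2r ?sqr_ge0// -natrX ler_nat -mulnn.
by case: (n) => // m; exact: leq_pmull.
Qed.

Lemma rV_norm_le x (r : R) : 0 <= r -> (forall i, `|x 0 i| <= r) -> `|x| <= r.
Proof.
move=> r0 xr; rewrite [leLHS]/Num.norm/= mx_normrE.
by apply/bigmax_leP; split => // -[i j] _ /=; rewrite (ord1 i).
Qed.

Lemma continuous_edot b : continuous (fun x => edot x b).
Proof.
apply: continuous_big => [|i _]; first exact: add_continuous.
move=> x; apply: continuousM; last exact: cst_continuous.
exact: (@coord_continuous _ _ _ 0 i).
Qed.

Lemma continuous_edotxx : continuous (fun x => edot x x).
Proof.
apply: continuous_big => [|i _]; first exact: add_continuous.
by move=> x; apply: continuousM; exact: (@coord_continuous _ _ _ 0 i).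
Qed.

Lemma continuous_enorm : continuous (@enorm R n).
Proof.
move=> x; apply: (continuous_comp (f := fun x => edot x x)).
  exact: continuous_edotxx.
exact: sqrt_continuous.
Qed.

Definition gram x b : R := edot x x * edot b b - edot x b ^+ 2.

(** Up to a factor, [gram x b] is the squared length of the component of [x]
orthogonal to [b]. This gives both the Cauchy-Schwarz inequality and its equality
case. *)
Lemma sqr_rejection x b :
  edot (edot b b *: x - edot x b *: b) (edot b b *: x - edot x b *: b) =
  edot b b * gram x b.
Proof.
rewrite -scaleNr !(edotDl, edotDr, edotZl, edotZr) /gram (edotC b x); ring.
Qed.

Lemma gram_ge0 x b : 0 <= gram x b.
Proof.
have [->|b0] := eqVneq b 0.
  by rewrite /gram !edot0r mulr0 expr0n subrr.
by rewrite -(pmulr_rge0 _ (_ : 0 < edot b b)) ?edot_gt0// -sqr_rejection edot_ge0.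
Qed.

Lemma gram_eq0 x b : b != 0 ->
  (gram x b == 0) = (enorm b ^+ 2 *: x == edot x b *: b).
Proof.
move=> b0; rewrite sqr_enorm -[RHS]subr_eq0 -[RHS]edot_eq0 sqr_rejection.
by rewrite mulf_eq0 edot_eq0 (negPf b0).
Qed.

Lemma gram_shift x b (t : R) : gram (x - t *: b) b = gram x b.
Proof.
rewrite /gram -scaleNr !(edotDl, edotDr, edotZl, edotZr) (edotC b x); ring.
Qed.

Lemma edot_shift x b (t : R) :
  edot (x - t *: b) (x - t *: b) * edot b b =
  gram x b + (t * edot b b - edot x b) ^+ 2.
Proof.
rewrite /gram -scaleNr !(edotDl, edotDr, edotZl, edotZr) (edotC b x); ring.
Qed.

Lemma continuous_gram b : continuous (gram ^~ b).
Proof.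
move=> x; apply: (@continuousB _ R 'rV[R]_n (fun x => edot x x * edot b b)
    (fun x => edot x b ^+ 2)).
  apply: continuousM; [exact: continuous_edotxx|exact: cst_continuous].
by apply: continuousM; exact: continuous_edot.
Qed.

(** With [r] the distance from [x] to the line spanned by [b], this is
[`|b| * r / `|x|^2]. It is comparable to [1 / `|x|] away from the direction of
[b], and along the lines parallel to [b] it is a Poisson kernel. *)
Definition poisson b x : R := Num.sqrt (gram x b) / edot x x.

Lemma poisson_ge0 b x : 0 <= poisson b x.
Proof. by rewrite divr_ge0 ?sqrtr_ge0 ?edot_ge0. Qed.

Lemma measurable_poisson b : measurable_rV (poisson b).
Proof.
apply: measurable_funM.
  apply: (@continuous_measurable_rV _ _ (fun x => Num.sqrt (gram x b))) => x.
  apply: (continuous_comp (f := gram ^~ b)); first exact: continuous_gram.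
  exact: sqrt_continuous.
apply: (@measurable_rV_inv _ _ (fun x => edot x x)); last exact: edot_ge0.
exact: (continuous_measurable_rV continuous_edotxx).
Qed.

(** Unless it vanishes, the integrand is the derivative of the arctangent of an affine function of
[t], and the arctangent varies by at most [pi]. *)
Lemma integral_poisson_le b x (T : R) : b != 0 -> 0 < T ->
  (\int[lebesgue_measure]_(t in `[0%R, T]) (poisson b (x - t *: b)%R)%:E
   <= (@pi R)%:E)%E.
Proof.
move=> b0 T0.
have [g0|g0] := eqVneq (gram x b) 0.
  rewrite integral0_eq ?lee_fin ?pi_ge0// => t _.
  by rewrite /poisson gram_shift g0 sqrtr0 mul0r.
have {}g0 : 0 < gram x b by rewrite lt_def g0 gram_ge0.
have B0 : 0 < edot b b by rewrite edot_gt0.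
set r := Num.sqrt (gram x b).
have r0 : 0 < r by rewrite sqrtr_gt0.
have r2 : r ^+ 2 = gram x b by rewrite sqr_sqrtr// ltW.
pose phi (t : R) := (t * edot b b - edot x b) / r.
have dphi (t : R) : is_derive t 1 phi (edot b b / r).
  rewrite /phi.
  apply: is_derive_eq; rewrite /GRing.scale/=; ring.
pose f (t : R) := (oneDsqr (phi t))^-1 * (edot b b / r).
have fE t : poisson b (x - t *: b) = f t.
  have rt : 0 < r ^+ 2 + (t * edot b b - edot x b) ^+ 2.
    by rewrite ltr_pwDl ?exprn_gt0// sqr_ge0.
  rewrite /poisson gram_shift -/r.
  rewrite -[edot (_ - _) _](mulfK (lt0r_neq0 B0)) edot_shift -r2 /f /oneDsqr /phi.
  by field; rewrite !lt0r_neq0//.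
have cf : continuous f.
  move=> t; apply: (@continuousM R R (fun t => (oneDsqr (phi t))^-1) (cst (edot b b / r))).
    2: exact: cst_continuous.
  apply: (@continuous_comp R R R phi (fun s => (oneDsqr s)^-1)).
    exact/differentiable_continuous/derivable1_diffP.
  exact: continuous_oneDsqrV.
pose F (t : R) := atan (phi t).
have dF (t : R) : is_derive t 1 F (f t).
  exact: (@is_derive1_comp R atan phi t _ _ (is_derive1_atan _) (dphi t)).
have cF : continuous F.
  by move=> t; exact/differentiable_continuous/derivable1_diffP.
under eq_integral do rewrite fE.
rewrite (@continuous_FTC2 _ f F)//.
- rewrite -EFinB lee_fin.
  have := atan_ltpi2 (phi T); have := atan_gtNpi2 (phi 0).
  rewrite /F; lra.
- by apply: continuous_subspaceT.
- split; first by move=> t _; exact: ex_derive.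
  + by apply: cvg_at_right_filter; exact: cF.
  + by apply: cvg_at_left_filter; exact: cF.
- by move=> t _; rewrite derive1E derive_val.
Qed.

End euclidean.

(** * Directional derivatives *)
Section directional_derivative.
Context {R : realType} {n : nat}.
Implicit Types (x d : 'rV[R]_n).

Lemma is_derive_lineP (V : normedModType R) (f : 'rV[R]_n -> V) x d (t : R) df :
  is_derive t 1 (fun s : R => f (x + s *: d)) df <->
  is_derive (x + t *: d) d f df.
Proof.
have E : (fun h : R => h^-1 *: (((fun s : R => f (x + s *: d)) \o shift t)
      (h *: 1) - f (x + t *: d))) =
    (fun h : R => h^-1 *: ((f \o shift (x + t *: d)) (h *: d)
      - f (x + t *: d))).
  apply/funext => h /=; congr (_ *: (f _ - _)).
  by rewrite (_ : h *: (1 : R) = h) ?[LHS]mulr1// scalerDl addrCA.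
by split => -[dd Dd]; split; [move: dd|move: Dd|move: dd|move: Dd];
   rewrite /derivable /derive E.
Qed.

Lemma is_derive_linear (V W : normedModType R) (L : V -> W)
    (f : 'rV[R]_n -> V) x d :
  (forall (c : R) v w, L (c *: (v - w)) = c *: (L v - L w)) -> continuous L ->
  derivable f x d -> is_derive x d (L \o f) (L ('D_d f x)).
Proof.
move=> linL cL df.
have E : (fun h : R => h^-1 *: (((L \o f) \o shift x) (h *: d) - (L \o f) x)) =
    L \o (fun h : R => h^-1 *: ((f \o shift x) (h *: d) - f x)).
  by apply/funext => h /=; rewrite linL.
have cvgL : L (h^-1 *: ((f \o shift x) (h *: d) - f x))
    @[h --> (0 : R)^'] --> L ('D_d f x).
  apply: (@cvg_comp _ _ _ (fun h : R => h^-1 *: ((f \o shift x) (h *: d) - f x))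
    L _ (nbhs ('D_d f x))) => //; exact: cL.
split; first by rewrite /derivable E; apply: cvgP cvgL.
by rewrite /derive E; apply: cvg_lim.
Qed.

End directional_derivative.

(** * The weighted inequality along one direction *)
Section line.
Context {R : realType} {n : nat}.
Local Notation mT := (measurableTypeR R).
Local Notation leb := (@lebesgue_measure R).
Implicit Types x b : 'rV[R]_n.

Lemma continuous_line x b : continuous (fun t : R => x + t *: b).
Proof.
move=> t; apply: (@continuousD _ 'rV[R]_n R (cst x) (fun t => t *: b)).
  exact: cst_continuous.
exact: scalel_continuous.
Qed.

(** The fundamental theorem of calculus, started from a point of the line where
[f] vanishes. *)
Lemma norm_le_integral_line (f : 'rV[R]_n -> R) x b (T : R) :
  (forall y, derivable f y b) -> continuous (fun y => 'D_b f y) ->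
  0 < T -> f (x + T *: b) = 0 ->
  (`|f x|%:E <= \int[leb]_(t in `[0%R, T]) `|'D_b f (x + t *: b)%R|%:E)%E.
Proof.
move=> df cdf T0 fT.
pose F (t : R) := f (x + t *: b); pose g (t : R) := 'D_b f (x + t *: b).
have dF (t : R) : is_derive t 1 F (g t) by apply/is_derive_lineP/derivableP.
have cF : continuous F.
  by move=> t; exact/differentiable_continuous/derivable1_diffP.
have cg : continuous g.
  move=> t; apply: (@continuous_comp R 'rV[R]_n R (fun s : R => x + s *: b)
    (fun y => 'D_b f y)).
    exact: continuous_line.
  exact: cdf.
have mg : measurable_fun [set: R] (EFin \o g).
  by apply/measurable_EFinP; exact: continuous_measurable_fun.
have FTC : (\int[leb]_(t in `[0%R, T]) (g t)%:E = (F T)%:E - (F 0)%:E)%E.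
  apply: continuous_FTC2 => //.
  - exact: continuous_subspaceT.
  - split; first by move=> t _; exact: ex_derive.
    + by apply: cvg_at_right_filter; exact: cF.
    + by apply: cvg_at_left_filter; exact: cF.
  - by move=> t _; rewrite derive1E derive_val.
have := @le_abse_integral _ mT R leb `[0, T]%classic (EFin \o g).
rewrite /= FTC /F fT scale0r addr0 add0e abseN /=.
by apply => //; exact: measurable_funTS.
Qed.

End line.

Section weighted.
Context {R : realType} {n : nat}.
Local Notation mT := (measurableTypeR R).
Local Notation leb := (@lebesgue_measure R).
Local Notation mu := (lebesgue_measure_tuple R n).
Implicit Types (b : 'rV[R]_n) (f g : 'rV[R]_n -> R).

(** Tonelli and translation invariance move the integration along the lines
parallel to [b] from [g] onto the weight. *)
Lemma integral_weight_line (w f g : 'rV[R]_n -> R) b (T K : R) :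
  measurable_rV w -> measurable_rV f -> measurable_rV g ->
  (forall x, 0 <= w x) -> (forall x, 0 <= f x) -> (forall x, 0 <= g x) ->
  0 <= K ->
  (forall x, (f x)%:E <=
    \int[leb]_(t in `[0%R, T]) (g (x + t *: b)%R)%:E)%E ->
  (forall x, \int[leb]_(t in `[0%R, T]) (w (x - t *: b)%R)%:E <= K%:E)%E ->
  (integral_rV (fun x => w x * f x)%R <= K%:E * integral_rV g)%E.
Proof.
move=> mw mf mg w0 f0 g0 K0 fg wK.
pose I (t : mT) : R := \1_(`[0, T]%classic) t.
have mI : measurable_fun setT I by exact: measurable_indic.
have I0 t : 0 <= I t by rewrite /I indicE.
have integralI (h : R -> R) :
    (\int[leb]_(t in `[0%R, T]) (h t)%:E = \int[leb]_t (h t * I t)%:E)%E.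
  rewrite integral_mkcond; apply: eq_integral => t _.
  by rewrite patchE /I indicE; case: ifP; rewrite ?mulr1 ?mulr0.
pose h (p : n.-tuple mT * mT) :=
  w (tuple_rV p.1) * g (tuple_rV p.1 + (p.2 : R) *: b) * I p.2.
have mh : measurable_fun setT h.
  apply: measurable_funM; last exact: measurableT_comp.
  apply: measurable_funM; last exact: measurable_rV_line.
  exact: (@measurableT_comp _ _ _ _ _ _ (fun t => w (tuple_rV t))).
pose k (p : n.-tuple mT * mT) :=
  w (tuple_rV p.1 + (p.2 : R) *: (- b)) * g (tuple_rV p.1) * I p.2.
have mk : measurable_fun setT k.
  apply: measurable_funM; last exact: measurableT_comp.
  apply: measurable_funM; first exact: measurable_rV_line.
  exact: (@measurableT_comp _ _ _ _ _ _ (fun t => g (tuple_rV t))).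
have h0 p : 0 <= h p by rewrite !mulr_ge0.
have k0 p : 0 <= k p by rewrite !mulr_ge0.
apply: (@le_trans _ _ (\int[mu]_x \int[leb]_t (h (x, t))%:E)%E).
  apply: ge0_le_integral => //.
  - by move=> x _; rewrite lee_fin mulr_ge0.
  - by apply/measurable_EFinP; exact: measurable_funM.
  - apply: (measurable_fun_fubini_tonelli_F (EFin \o h)) => [|p].
      exact/measurable_EFinP.
    by rewrite lee_fin.
  move=> x _; under eq_integral do rewrite /h/= -mulrA EFinM.
  rewrite ge0_integralZl//; last 3 first.
  - apply/measurable_EFinP; apply: measurable_funM => //.
    by apply: (measurableT_comp (measurable_rV_line b mg) (pair1_measurable x)).
  - by move=> t _; rewrite lee_fin mulr_ge0.
  - by rewrite lee_fin.
  by rewrite EFinM lee_wpmul2l ?lee_fin// -integralI; exact: fg.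
rewrite (@fubini_tonelli _ _ _ _ _ mu leb (EFin \o h))/=; last 2 first.
  exact/measurable_EFinP.
  by move=> p; rewrite lee_fin.
have -> : (\int[leb]_t \int[mu]_x (h (x, t))%:E =
           \int[leb]_t \int[mu]_x (k (x, t))%:E)%E.
  apply: eq_integral => t _.
  rewrite -(ge0_integral_shift_tuple (t *: b)
      (f := fun x => (k (x, t))%:E)); first last.
  - by move=> x; rewrite lee_fin.
  - by apply/measurable_EFinP; apply: (measurableT_comp mk (pair2_measurable t)).
  apply: eq_integral => x _; congr EFin.
  by rewrite /h /k /= tuple_rV_shift scalerN addrK.
rewrite -(@fubini_tonelli _ _ _ _ _ mu leb (EFin \o k))/=; last 2 first.
  exact/measurable_EFinP.
  by move=> p; rewrite lee_fin.
rewrite -ge0_integralZl//; last 2 first.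
  exact/measurable_EFinP.
  by move=> t _; rewrite lee_fin.
apply: ge0_le_integral => //.
- by move=> x _; apply: integral_ge0 => t _; rewrite lee_fin.
- apply: (measurable_fun_fubini_tonelli_F (EFin \o k)) => [|p].
    exact/measurable_EFinP.
  by rewrite lee_fin.
- by apply: measurable_funeM; exact/measurable_EFinP.
move=> x _; under eq_integral do rewrite /k/= mulrAC mulrC EFinM scalerN.
rewrite ge0_integralZl//; last 3 first.
- apply/measurable_EFinP; apply: measurable_funM => //.
  under eq_fun do rewrite -scalerN.
  by apply: (measurableT_comp (measurable_rV_line (- b) mw) (pair1_measurable x)).
- by move=> t _; rewrite lee_fin mulr_ge0.
- by rewrite lee_fin.
by rewrite muleC lee_wpmul2r ?lee_fin// -integralI; exact: wK.
Qed.

Lemma integral_poisson_derive (f : 'rV[R]_n -> R) b (T : R) : b != 0 ->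
  continuous f -> (forall x, derivable f x b) ->
  continuous (fun x => 'D_b f x) ->
  0 < T -> (forall x, f x != 0 -> f (x + T *: b) = 0) ->
  (integral_rV (fun x => poisson b x * `|f x|)%R
   <= (@pi R)%:E * integral_rV (fun x => `|'D_b f x|)%R)%E.
Proof.
move=> b0 cf df cdf T0 fT.
have mnorm (h : 'rV[R]_n -> R) : continuous h ->
    measurable_rV (fun x => `|h x|).
  move=> ch; apply: (@measurableT_comp _ _ _ _ _ _ (@Num.norm _ R)) => //.
  exact: continuous_measurable_rV.
apply: (@integral_weight_line _ _ _ b T) => //.
- exact: measurable_poisson.
- exact: mnorm.
- exact: mnorm.
- exact: poisson_ge0.
- exact: pi_ge0.
- move=> x; have [fx|fx] := eqVneq (f x) 0.
    by rewrite fx normr0; apply: integral_ge0 => t _; rewrite lee_fin.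
  exact: norm_le_integral_line (fT _ fx).
- by move=> x; exact: integral_poisson_le.
Qed.

End weighted.

(** * Coercivity of the symbol *)
Section dot_product.
Context {R : realType} {V : normedVectType R} {dot : {dot V for idfun}}.
Hypothesis norm_dot : forall v : V, `|v| = Num.sqrt (dot v v).
Implicit Types a v w : V.

Lemma dotC v w : dot v w = dot w v.
Proof. by rewrite hermC /= expr0 mul1r. Qed.

Lemma dot_ge0 v : 0 <= dot v v.
Proof.
have [->|v0] := eqVneq v 0; first by rewrite linear0.
exact/ltW/neq0_dnorm_gt0.
Qed.

Lemma sqr_norm_dot v : `|v| ^+ 2 = dot v v.
Proof. by rewrite norm_dot sqr_sqrtr// dot_ge0. Qed.

Lemma dot_cauchy_schwarz v w : `|dot v w| <= `|v| * `|w|.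
Proof.
have [->|w0] := eqVneq w 0; first by rewrite linear0 normr0 mulr_ge0.
have B0 : 0 < dot w w by exact: neq0_dnorm_gt0.
rewrite -(@ler_pXn2r _ 2)// ?nnegrE ?mulr_ge0// exprMn real_normK ?num_real//.
rewrite !sqr_norm_dot -subr_ge0 -(pmulr_rge0 _ B0).
rewrite (_ : _ * _ = dot (dot w w *: v - dot v w *: w)
  (dot w w *: v - dot v w *: w)) ?dot_ge0//.
have dotBZl x y c d z : dot (c *: x - d *: y) z = c * dot x z - d * dot y z.
  by rewrite (dotC _ z) linearB !linearZ /= !(dotC z).
rewrite dotBZl !(dotC _ (_ - _)) !dotBZl (dotC w v); ring.
Qed.

Lemma continuous_dot a : continuous (dot a).
Proof.
move=> v; apply/cvgrPdist_lt => e e0.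
have a1 : 0 < 1 + `|a| by rewrite ltr_pwDl.
near=> w; rewrite -linearB (le_lt_trans (dot_cauchy_schwarz _ _))//.
rewrite (@le_lt_trans _ _ ((1 + `|a|) * `|v - w|)) ?ler_wpM2r ?lerDr//.
rewrite mulrC -ltr_pdivlMr//.
near: w; apply: (cvgr_dist_lt id v); first exact: cvg_id.
by rewrite divr_gt0.
Unshelve. all: by end_near. Qed.

Lemma is_derive_dot n (u : 'rV[R]_n -> V) a x b : derivable u x b ->
  is_derive x b (fun y => dot a (u y)) (dot a ('D_b u x)).
Proof.
move=> du.
apply: (@is_derive_linear _ _ _ R) => // [c v w|]; last exact: continuous_dot.
by rewrite linearZ /= linearB.
Qed.

End dot_product.

Section coercive.
Context {R : realType} {V : normedVectType R} {dot : {dot V for idfun}}.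
Context {n l : nat} (a : 'I_l -> V) (b : 'I_l -> 'rV[R]_n).
Import VectorInternalTheory.

Definition esphere (m : nat) : set 'rV[R]_m := [set x | enorm x = 1].

Lemma compact_esphere m : compact (@esphere m).
Proof.
apply: bounded_closed_compact.
  exists 1; split; first exact: num_real.
  move=> M M1 x x1 /=; rewrite (le_trans _ (ltW M1))// -x1.
  by apply: rV_norm_le => [|i]; [exact: enorm_ge0|exact: coord_le_enorm].
rewrite (_ : @esphere m = (@enorm R m) @^-1` [set 1]); last by [].
apply: preimage_closed => [x _|]; first exact: continuous_enorm.
exact: closed_eq.
Qed.

Lemma norm_r2v_le : exists2 K : R, 0 < K &
  forall c : 'rV[R]_(dim V), `|r2v c : V| <= K * enorm c.
Proof.
pose e i : V := r2v (delta_mx 0 i).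
exists (1 + \sum_i `|e i|) => [|c]; first by rewrite ltr_pwDl// sumr_ge0.
rewrite [in leLHS](row_sum_delta c) linear_sum.
rewrite (le_trans (ler_norm_sum _ _ _))// mulrDl mul1r.
rewrite -[leLHS]add0r lerD ?enorm_ge0// mulr_suml ler_sum// => i _.
by rewrite linearZ normrZ mulrC ler_wpM2l// coord_le_enorm.
Qed.

Hypothesis spanning : forall (xi : 'rV[R]_n) (v : V), xi != 0 -> v != 0 ->
  exists i : 'I_l,
    dot (a i) v != 0 /\ (enorm (b i)) ^+ 2 *: xi != edot xi (b i) *: b i.
Hypothesis (b_neq0 : forall i, b i != 0).

(** The vector of [V] is replaced by its coordinates, so that compactness is only
used for spheres of row vectors. *)
Definition symbol (p : 'rV[R]_n * 'rV[R]_(dim V)) : R :=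
  \sum_(i < l) `|dot (a i) (r2v p.2)| * Num.sqrt (gram p.1 (b i)).

Lemma continuous_symbol : continuous symbol.
Proof.
apply: continuous_big => [|i _]; first exact: add_continuous.
pose alpha : 'rV[R]_(dim V) := \row_k dot (a i) (r2v (delta_mx 0 k)).
have dotE c : dot (a i) (r2v c) = edot c alpha.
  rewrite {1}(row_sum_delta c) !linear_sum; apply: eq_bigr => k _.
  by rewrite !linearZ mxE.
under eq_fun do rewrite dotE.
move=> p; apply: (@continuousM R ('rV[R]_n * 'rV[R]_(dim V))%type
    (fun p => `|edot p.2 alpha|) (fun p => Num.sqrt (gram p.1 (b i)))).
  apply: (@continuous_comp _ _ _ snd (fun c => `|edot c alpha|)).
    exact: cvg_snd.
  apply: continuous_comp; first exact: continuous_edot.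
  exact: norm_continuous.
apply: (@continuous_comp _ _ _ fst (fun x => Num.sqrt (gram x (b i)))).
  exact: cvg_fst.
apply: (continuous_comp (f := fun x => gram x (b i))).
  exact: continuous_gram.
exact: sqrt_continuous.
Qed.

Lemma enorm_normalize m (x : 'rV[R]_m) : x != 0 ->
  @esphere m ((enorm x)^-1 *: x).
Proof.
move=> x0; rewrite /esphere/= enormZ ger0_norm ?invr_ge0 ?enorm_ge0//.
by rewrite mulVf// enorm_eq0.
Qed.

(** The infimum of [symbol] over the product of the unit spheres is attained, hence
positive, and both sides are homogeneous of degree one in [x] and in [v]. *)
Lemma coercive : (exists x : 'rV[R]_n, x != 0) -> (exists v : V, v != 0) ->
  exists2 c : R, 0 < c & forall (x : 'rV[R]_n) (v : V),
    c * (enorm x * `|v|) <=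
      \sum_(i < l) `|dot (a i) v| * Num.sqrt (gram x (b i)).
Proof.
move=> [x1 x1_neq0] [v1 v1_neq0].
have r2v_neq0 (c : 'rV[R]_(dim V)) : c != 0 -> r2v c != 0 :> V.
  by apply: contra_neq => c0; apply: (can_inj r2vK); rewrite c0 linear0.
have v2r_neq0 (v : V) : v != 0 -> v2r v != 0.
  by apply: contra_neq => v0; apply: (can_inj v2rK); rewrite v0 linear0.
have esphere_neq0 m (x : 'rV[R]_m) : @esphere m x -> x != 0.
  by move=> x_1; rewrite -enorm_eq0 x_1 oner_neq0.
pose S := (@esphere n `*` @esphere (dim V)).
have S0 : S !=set0.
  exists ((enorm x1)^-1 *: x1, (enorm (v2r v1))^-1 *: v2r v1).
  by split; apply: enorm_normalize => //; exact: v2r_neq0.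
have cS : compact S by apply: compact_setX; exact: compact_esphere.
have [p] := compact_EVT_min S0 cS (continuous_subspaceT continuous_symbol).
rewrite inE => -[p1 p2] pmin.
have symbol_gt0 : 0 < symbol p.
  have [i [dot_i gram_i]] := spanning (esphere_neq0 _ _ p1)
    (r2v_neq0 _ (esphere_neq0 _ _ p2)).
  rewrite /symbol (bigD1 i)//= ltr_pwDl//.
    by rewrite mulr_gt0 ?normr_gt0// sqrtr_gt0 lt_def gram_ge0 andbT gram_eq0.
  by apply: sumr_ge0 => j _; rewrite mulr_ge0 ?sqrtr_ge0.
have [K K0 normK] := norm_r2v_le.
exists (symbol p / K) => [|x v]; first by rewrite divr_gt0.
have [->|x0] := eqVneq x 0.
  rewrite (_ : enorm 0 = 0) ?mul0r ?mulr0; last by apply/eqP; rewrite enorm_eq0.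
  by apply: sumr_ge0 => j _; rewrite mulr_ge0 ?sqrtr_ge0.
have [->|v0] := eqVneq v 0.
  rewrite normr0 !mulr0.
  by apply: sumr_ge0 => j _; rewrite mulr_ge0 ?sqrtr_ge0.
have ex0 : 0 < enorm x by rewrite enorm_gt0.
have ev0 : 0 < enorm (v2r v) by rewrite enorm_gt0 v2r_neq0.
have := pmin ((enorm x)^-1 *: x, (enorm (v2r v))^-1 *: v2r v).
rewrite inE => /(_ _)/wrap[].
  by split; apply: enorm_normalize => //; exact: v2r_neq0.
have -> : symbol ((enorm x)^-1 *: x, (enorm (v2r v))^-1 *: v2r v) =
    (enorm x * enorm (v2r v))^-1 *
    \sum_(i < l) `|dot (a i) v| * Num.sqrt (gram x (b i)).
  rewrite /symbol mulr_sumr; apply: eq_bigr => i _ /=.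
  rewrite !linearZ /= v2rK normrM !(ger0_norm (_ : 0 <= _^-1)) ?invr_ge0 ?enorm_ge0//.
  rewrite (_ : gram _ _ = (enorm x)^-1 ^+ 2 * gram x (b i)); last first.
    by rewrite /gram !edotZl !edotZr; ring.
  rewrite sqrtrM ?sqr_ge0// sqrtr_sqr !(ger0_norm (_ : 0 <= _^-1)) ?invr_ge0 ?enorm_ge0//.
  by rewrite invfM; ring.
rewrite mulrC ler_pdivlMr ?mulr_gt0// => /(le_trans _); apply.
rewrite -mulrA ler_pM2l// mulrCA ler_pM2l// mulrC ler_pdivrMr//.
by have := normK (v2r v); rewrite v2rK mulrC.
Qed.

End coercive.

(** * From the algebraic condition to the Hardy inequality *)
Section sufficiency.
Context {R : realType} {V : normedVectType R} {dot : {dot V for idfun}}.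
Hypothesis norm_dot : forall v : V, `|v| = Num.sqrt (dot v v).
Context {n l : nat} (a : 'I_l -> V) (b : 'I_l -> 'rV[R]_n).
Hypothesis (b_neq0 : forall i, b i != 0).

(** The length [T] is the same for all [x]: it serves as a common upper limit of
integration on all the lines parallel to [d]. *)
Lemma compact_support_line (u : 'rV[R]_n -> V) (d : 'rV[R]_n) : d != 0 ->
  compact (closure [set x | u x != 0]) ->
  exists2 T : R, 0 < T & forall x, u x != 0 -> u (x + T *: d) = 0.
Proof.
move=> d0 /compact_bounded[M [_ uM]].
have {}uM x : u x != 0 -> `|x| <= `|M| + 1.
  move=> ux; apply: (uM (`|M| + 1)); last exact: subset_closure.
  by rewrite (le_lt_trans (ler_norm M))// ltrDl.
have d1 : 0 < `|d| by rewrite normr_gt0.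
(* Moving by more than the diameter of a ball that contains the support. *)
exists ((`|M| + 1 + (`|M| + 1) + 1) / `|d|) => [|x ux].
  by rewrite divr_gt0// !addr_gt0// ltr_wpDl.
apply/eqP/negPn/negP => /uM; apply/negP; rewrite -ltNge.
set T := _ / _.
have : `|T *: d| = `|M| + 1 + (`|M| + 1) + 1.
  rewrite normrZ /T normrM normfV normr_id divfK ?gt_eqF//.
  by rewrite ger0_norm// !addr_ge0.
have := ler_normB (x + T *: d) x; rewrite addrC addrA addNr add0r.
by have := uM _ ux; lra.
Qed.

Lemma hardy_sufficient (C : R) : 0 < C ->
  (forall x v, C * (enorm x * `|v|) <=
    \sum_(i < l) `|dot (a i) v| * Num.sqrt (gram x (b i))) ->
  forall u : 'rV[R]_n -> V, smooth_compact_support u ->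
    (integral_rV (fun x => (`|u x| / enorm x)%R)
      <= (C^-1 * pi)%:E *
         \sum_(i < l) integral_rV (fun x => `|dot (a i) ('D_(b i) u x)|%R))%E.
Proof.
move=> C0 coer u [Cu cu].
have ctu : continuous u := Cu 0.
have du d x : derivable u x d by have [_ /(_ d)[]] := Cu 1.
have cdu d : continuous (fun x => 'D_d u x) by have [_ /(_ d)[]] := Cu 1.
pose f i x := dot (a i) (u x).
have cdot := continuous_dot norm_dot.
have cf i : continuous (f i).
  by move=> x; apply: continuous_comp; [exact: ctu|exact: cdot].
have df i x : is_derive x (b i) (f i) (dot (a i) ('D_(b i) u x)).
  exact: is_derive_dot.
have DfE i : (fun x => 'D_(b i) (f i) x) = (fun x => dot (a i) ('D_(b i) u x)).
  by apply/funext => x; rewrite derive_val.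
have cdf i : continuous (fun x => 'D_(b i) (f i) x).
  rewrite DfE => x; apply: (continuous_comp (f := fun x => 'D_(b i) u x)).
    exact: cdu.
  exact: cdot.
have mpf i : measurable_rV (fun x => poisson (b i) x * `|f i x|).
  apply: measurable_funM; first exact: measurable_poisson.
  apply: (@continuous_measurable_rV _ _ (fun x => `|f i x|)) => x.
  by apply: continuous_comp; [exact: cf|exact: norm_continuous].
have pf0 i x : 0 <= poisson (b i) x * `|f i x|.
  by rewrite mulr_ge0// poisson_ge0.
have msum : measurable_rV (fun x => \sum_(i < l) poisson (b i) x * `|f i x|).
  exact: (@measurable_rV_sum _ _ _ _ (fun i x => poisson (b i) x * `|f i x|)).
apply: (@le_trans _ _
    (integral_rV (fun x => C^-1 * \sum_(i < l) poisson (b i) x * `|f i x|)%R)).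
  apply: le_integral_rV.
  - apply: measurable_funM.
      apply: (@continuous_measurable_rV _ _ (fun x => `|u x|)) => x.
      by apply: continuous_comp; [exact: ctu|exact: norm_continuous].
    apply: (@measurable_rV_inv _ _ (@enorm R n)); last exact: enorm_ge0.
    exact: (continuous_measurable_rV continuous_enorm).
  - exact: measurable_funM.
  - by move=> x; rewrite divr_ge0 ?enorm_ge0.
  (* At the origin both sides vanish, by the convention on the inverse of 0. *)
  move=> x; have [->|x0] := eqVneq x 0.
    rewrite (_ : enorm 0 = 0) ?invr0 ?mulr0; last by apply/eqP; rewrite enorm_eq0.
    by rewrite mulr_ge0 ?invr_ge0 ?(ltW C0)// sumr_ge0.
  have ex0 : 0 < enorm x by rewrite enorm_gt0.
  rewrite (_ : \sum_(i < l) _ = (enorm x ^+ 2)^-1 *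
      \sum_(i < l) `|dot (a i) (u x)| * Num.sqrt (gram x (b i))); last first.
    rewrite mulr_sumr; apply: eq_bigr => i _.
    by rewrite /poisson sqr_enorm; ring.
  have := coer x (u x).
  set S := \sum_(i < l) _ => CS.
  rewrite ler_pdivrMr// (_ : _ * _ * _ = S / (C * enorm x)); last first.
    by field; rewrite !gt_eqF.
  by rewrite ler_pdivlMr ?mulr_gt0// mulrC -mulrA.
rewrite integral_rVZl ?invr_ge0 ?(ltW C0)//; last first.
  by move=> x; exact: sumr_ge0.
rewrite EFinM -muleA lee_wpmul2l ?lee_fin ?invr_ge0 ?(ltW C0)//.
rewrite integral_rV_sum// ge0_sume_distrr; last first.
  by move=> i _; apply: integral_rV_ge0.
apply: lee_sum => i _.
rewrite (_ : (fun x => `|dot _ _|) = fun x => `|'D_(b i) (f i) x|); last first.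
  by apply/funext => x; rewrite derive_val.
have [T T0 uT] := compact_support_line (b_neq0 i) cu.
apply: (@integral_poisson_derive _ _ _ _ T) => //.
move=> x fx; rewrite /f uT ?linear0//.
by apply: contra_neq fx => ux; rewrite /f ux linear0.
Qed.

End sufficiency.

(** * Flat functions *)
Section flat.
Context {R : realType}.
Implicit Types (p : {poly R}) (s t : R).

(** The polynomial factor makes the family stable under differentiation. *)
Definition flat p t : R := if 0 < t then p.[t^-1] * expR (- t^-1) else 0.

(** With [y = t^-1], the derivative of [p(y) * exp (- y)] with respect to [t] is
[y^2 * (p(y) - p'(y)) * exp (- y)]. *)
Definition dflat p : {poly R} := 'X^2 * (p - p^`()).

Lemma flat_le0 p t : t <= 0 -> flat p t = 0.
Proof. by rewrite /flat ltNge => ->. Qed.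

Lemma exprn_expRN_le n (y : R) : 0 <= y -> y ^+ n.+1 * expR (- y) <= n.+1`!%:R.
Proof.
move=> y0; rewrite expRN ler_pdivrMr ?expR_gt0// mulrC -ler_pdivrMr; last first.
  by rewrite ltr0n fact_gt0.
by apply: le_trans (expR_ge1Dxn n y0); rewrite lerDr.
Qed.

(** The exponential dominates: [y ^ (i + 2) * exp (- y)] is at most [(i + 2)!]. The
exponent 2 is what differentiability at 0 requires. *)
Lemma flat_quadratic p : exists2 K : R, 0 < K & forall t, `|flat p t| <= K * t ^+ 2.
Proof.
exists (1 + \sum_(i < size p) `|p`_i| * i.+2`!%:R) => [|t].
  by rewrite ltr_pwDl// sumr_ge0// => i _; rewrite mulr_ge0.
rewrite /flat; case: ifPn => [t0|_]; last first.
  by rewrite normr0 mulr_ge0 ?sqr_ge0// addr_ge0// sumr_ge0// => i _; rewrite mulr_ge0.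
have y0 : 0 < t^-1 by rewrite invr_gt0.
rewrite -ler_pdivrMr ?exprn_gt0// -exprVn.
rewrite normrM [`|expR _|]ger0_norm ?expR_ge0//.
apply: (@le_trans _ _ (\sum_(i < size p) `|p`_i| * i.+2`!%:R)); last by rewrite lerDr.
rewrite -mulrA.
apply: (@le_trans _ _ ((\sum_(i < size p) `|p`_i| * t^-1 ^+ i) *
   (expR (- t^-1) * t^-1 ^+ 2))).
  apply: ler_wpM2r; first by rewrite mulr_ge0 ?expR_ge0 ?sqr_ge0.
  rewrite horner_coef (le_trans (ler_norm_sum _ _ _))// ler_sum// => i _.
  by rewrite normrM (ger0_norm (exprn_ge0 _ (ltW y0))).
rewrite mulr_suml ler_sum// => i _; rewrite -mulrA ler_wpM2l//.
rewrite mulrCA -exprD addn2 mulrC.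
exact: exprn_expRN_le (ltW y0).
Qed.

Global Instance is_derive_flat p t : is_derive t 1 (flat p) (flat (dflat p) t).
Proof.
have [t0|t0|->] := ltgtP t 0.
- rewrite [X in is_derive _ _ _ X]flat_le0 ?ltW//.
  apply: (@near_eq_is_derive _ _ _ (cst 0)).
  by near=> s; rewrite flat_le0//; apply/ltW; near: s; exact: lt_nbhsl.
- have ty : flat (dflat p) t =
      p.[t^-1] * (expR (- t^-1) * t^-1 ^+ 2) +
      expR (- t^-1) * (p^`().[t^-1] * - t^-1 ^+ 2).
    by rewrite /flat t0 /dflat hornerM hornerXn hornerD hornerN; ring.
  rewrite ty; apply: (@near_eq_is_derive _ _ _
      ((fun s => p.[s^-1]) * (fun s => expR (- s^-1)))).
  + by near=> s; rewrite /flat ifT//; near: s; exact: lt_nbhsr.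
  have dinv : is_derive t 1 (fun s : R => s^-1) (- t^-1 ^+ 2).
    have := @is_deriveV R (fun s => s) t 1 1 (lt0r_neq0 t0) (is_derive_id t 1).
    by move/is_derive_eq; apply; rewrite [LHS]mulr1 exprVn.
  have dp : is_derive t 1 (fun s : R => p.[s^-1]) (p^`().[t^-1] * - t^-1 ^+ 2).
    exact: (@is_derive1_comp _ (horner p) (fun s : R => s^-1)).
  have de : is_derive t 1 (fun s : R => expR (- s^-1))
      (expR (- t^-1) * t^-1 ^+ 2).
    apply: (@is_derive1_comp _ expR (fun s : R => - s^-1)).
    by apply: is_derive_eq; rewrite opprK.
  exact: is_deriveM.
- rewrite [X in is_derive _ _ _ X]flat_le0//.
  have [K K0 pK] := flat_quadratic p.
  suff cvg0 : h^-1 *: ((flat p \o shift 0) (h *: (1 : R)) - flat p 0)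
      @[h --> (0 : R)^'] --> (0 : R).
    split; first by apply: cvgP cvg0.
    exact: cvg_lim.
  apply/cvgrPdist_le => e e0; near=> h.
  rewrite (flat_le0 _ (lexx 0)) subr0 sub0r normrN /= addr0.
  rewrite normrM normfV [_ *: 1]mulr1.
  have h0 : 0 < `|h| by rewrite normr_gt0; near: h; exact: nbhs_dnbhs_neq.
  rewrite mulrC ler_pdivrMr// (le_trans (pK _))//.
  rewrite -real_normK ?num_real// expr2 mulrA ler_wpM2r//.
  rewrite mulrC -ler_pdivlMr//.
  near: h; apply: dnbhs0_le; exact: divr_gt0.
Unshelve. all: by end_near. Qed.

Lemma continuous_flat p : continuous (flat p).
Proof. by move=> t; exact/differentiable_continuous/derivable1_diffP. Qed.

End flat.

(** * Closure properties of C^k maps *)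
Section Ck_closure.
Context {R : realType} {n : nat}.
Implicit Types (f g : 'rV[R]_n -> R) (x d e : 'rV[R]_n).

Lemma CkS (V : normedModType R) k (u : 'rV[R]_n -> V) : Ck k.+1 u -> Ck k u.
Proof.
elim: k u => [|k IH] u; first by case.
by move=> [cu du]; split => // b; have [? ?] := du b; split => //; exact: IH.
Qed.

Lemma Ck_cst (V : normedModType R) k (v : V) : Ck k (fun _ : 'rV[R]_n => v).
Proof.
elim: k v => [|k IH] v /=; first exact: cst_continuous.
split => [|d]; first exact: cst_continuous.
split => [x|]; first exact: derivable_cst.
by under eq_fun do rewrite derive_cst; exact: IH.
Qed.

Lemma CkD k f g : Ck k f -> Ck k g -> Ck k (f \+ g).
Proof.
elim: k f g => [|k IH] f g /=.
  by move=> cf cg x; apply: (@continuousD _ R 'rV[R]_n f g x); [exact: cf|exact: cg].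
move=> [cf df] [cg dg]; split => [x|d].
  by apply: (@continuousD _ R 'rV[R]_n f g x); [exact: cf|exact: cg].
have [dfd cdf] := df d; have [dgd cdg] := dg d.
split => [x|]; first exact: derivableD.
rewrite (_ : (fun x => _) = (fun x => 'D_d f x) \+ (fun x => 'D_d g x)).
  exact: IH.
by apply/funext => x; rewrite /= deriveD.
Qed.

Lemma CkM k f g : Ck k f -> Ck k g -> Ck k (f \* g).
Proof.
elim: k f g => [|k IH] f g.
  by move=> cf cg x; apply: (@continuousM R 'rV[R]_n f g x); [exact: cf|exact: cg].
move=> Ckf Ckg; have [cf df] := Ckf; have [cg dg] := Ckg; split => [x|d].
  by apply: (@continuousM R 'rV[R]_n f g x); [exact: cf|exact: cg].
have [dfd cdf] := df d; have [dgd cdg] := dg d.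
split => [x|]; first exact: derivableM.
rewrite (_ : (fun x => _) =
    (f \* (fun x => 'D_d g x)) \+ (g \* (fun x => 'D_d f x))).
  by apply: CkD; apply: IH => //; exact: CkS.
by apply/funext => x; rewrite /= deriveM.
Qed.

Lemma Ck_prod k (I : Type) (s : seq I) (f : I -> 'rV[R]_n -> R) :
  (forall i, Ck k (f i)) -> Ck k (fun x => \prod_(i <- s) f i x).
Proof.
move=> Ckf; elim: s => [|i s IH].
  by under eq_fun do rewrite big_nil; exact: Ck_cst.
by under eq_fun do rewrite big_cons; exact: (CkM (Ckf i) IH).
Qed.

Lemma is_deriveZv (V : normedModType R) f (v : V) x d : derivable f x d ->
  is_derive x d (fun y => f y *: v) ('D_d f x *: v).
Proof.
move=> df.
apply: (@is_derive_linear _ _ R V ( *:%R^~ v)) => // [c r s|].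
  by rewrite -scalerBl scalerA.
exact: scalel_continuous.
Qed.

Lemma CkZv (V : normedModType R) k f (v : V) :
  Ck k f -> Ck k (fun x => f x *: v).
Proof.
have cZ g : continuous g -> continuous (fun x => g x *: v).
  move=> cg x; apply: (@continuous_comp _ _ _ g (fun r : R => r *: v)).
    exact: cg.
  exact: scalel_continuous.
elim: k f => [|k IH] f /=; first exact: cZ.
move=> [cf df]; split => [x|d]; first exact: cZ.
have [dfd cdf] := df d.
have dv x := is_deriveZv v (dfd x).
split => [x|]; first exact: ex_derive.
by under eq_fun do rewrite derive_val; exact: IH.
Qed.

Lemma is_derive_affine (h : R -> R) (h' : R) e (r : R) x d :
  is_derive (edot x e + r) 1 h h' ->
  is_derive x d (fun y => h (edot y e + r)) (h' * edot d e).
Proof.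
move=> dh; rewrite -[x]addr0 -(scale0r d); apply/is_derive_lineP.
pose a (t : R) := edot (x + t *: d) e + r.
have da : is_derive (0 : R) 1 a (edot d e).
  rewrite (_ : a = fun t : R => t * edot d e + (edot x e + r)); last first.
    by apply/funext => t; rewrite /a edotDl edotZl; ring.
  by apply: is_derive_eq; rewrite /GRing.scale/=; ring.
by apply: (@is_derive1_comp _ h a) => //; rewrite /a scale0r addr0.
Qed.

Lemma Ck_flat k (p : {poly R}) e (r : R) :
  Ck k (fun x => flat p (edot x e + r)).
Proof.
have cflat q : continuous (fun x => flat q (edot x e + r)).
  move=> x; apply: (@continuous_comp _ _ _ (fun x => edot x e + r) (flat q)).
    apply: (@continuousD _ R 'rV[R]_n (fun x => edot x e) (cst r)).
      exact: continuous_edot.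
    exact: cst_continuous.
  exact: continuous_flat.
elim: k p => [|k IH] p; first exact: cflat.
split=> [|d]; first exact: cflat.
have dd x := @is_derive_affine _ _ e r x d (is_derive_flat p (edot x e + r)).
split => [x|]; first exact: ex_derive.
under eq_fun do rewrite derive_val.
by apply: (CkM (IH _)); exact: Ck_cst.
Qed.

End Ck_closure.

(** * Bumps *)
Section bump.
Context {R : realType}.
Implicit Types s t : R.

(** On [`]-1, 1[] this is [exp (- 2 / (1 - s^2))]. *)
Definition bump s : R := flat 1 (1 - s) * flat 1 (1 + s).

Definition dbump s : R :=
  flat 1 (1 - s) * flat (dflat 1) (1 + s) -
  flat (dflat 1) (1 - s) * flat 1 (1 + s).

Lemma flat1_gt0 t : 0 < t -> flat 1 t = expR (- t^-1).
Proof. by rewrite /flat => ->; rewrite hornerC mul1r. Qed.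

Lemma flat1_ge0 t : 0 <= flat 1 t.
Proof.
have [t0|t0] := leP t 0; first by rewrite flat_le0.
by rewrite flat1_gt0// expR_ge0.
Qed.

Lemma flat1_le1 t : flat 1 t <= 1.
Proof.
have [t0|t0] := leP t 0; first by rewrite flat_le0.
by rewrite flat1_gt0// expR_le1 oppr_le0 invr_ge0 ltW.
Qed.

Lemma bump_ge0 s : 0 <= bump s.
Proof. by rewrite mulr_ge0 ?flat1_ge0. Qed.

Lemma bump_le1 s : bump s <= 1.
Proof. by rewrite mulr_ile1 ?flat1_ge0 ?flat1_le1. Qed.

Lemma bump_eq0 s : 1 <= `|s| -> bump s = 0.
Proof.
rewrite ler_normr /bump => /orP[s1|s1].
  by rewrite flat_le0 ?mul0r// subr_le0.
by rewrite (@flat_le0 _ _ (1 + s)) ?mulr0//; lra.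
Qed.

Lemma dbump_eq0 s : 1 <= `|s| -> dbump s = 0.
Proof.
rewrite ler_normr /dbump => /orP[s1|s1].
  by rewrite !(@flat_le0 _ _ (1 - s)) ?mul0r ?subrr// subr_le0.
by rewrite !(@flat_le0 _ _ (1 + s)) ?mulr0 ?subrr//; lra.
Qed.

Lemma bump_neq0 s : bump s != 0 -> `|s| < 1.
Proof. by apply: contra_neqT; rewrite -leNgt => /bump_eq0. Qed.

Lemma bump_ge_half s : `|s| <= 2^-1 -> expR (- 4) <= bump s.
Proof.
have flat_half t : 2^-1 <= t -> expR (- 2) <= flat 1 t.
  move=> t2; have t0 : 0 < t by lra.
  by rewrite flat1_gt0// ler_expR lerN2 -[leRHS]invrK lef_pV2 ?posrE ?invr_gt0.
rewrite ler_norml => /andP[s1 s2].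
rewrite (_ : - 4 = - 2 + - 2); last by lra.
by rewrite expRD ler_pM ?expR_ge0 ?flat_half//; lra.
Qed.

Lemma is_derive_bump s : is_derive s 1 bump (dbump s).
Proof.
have d1 : is_derive s 1 (fun t => flat 1 (1 - t)) (- flat (dflat 1) (1 - s)).
  have := @is_derive1_comp _ (flat 1) (fun t : R => 1 - t) s
    (flat (dflat 1) (1 - s)) (- 1) _ _.
  rewrite mulrN1; apply.
  by apply: is_derive_eq; ring.
have d2 : is_derive s 1 (fun t => flat 1 (1 + t)) (flat (dflat 1) (1 + s)).
  have := @is_derive1_comp _ (flat 1) (fun t : R => 1 + t) s
    (flat (dflat 1) (1 + s)) 1 _ _.
  rewrite mulr1; apply.
  by apply: is_derive_eq; ring.
have := is_deriveM d1 d2; move/is_derive_eq; apply.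
by rewrite /GRing.scale/= /dbump; ring.
Qed.

Lemma dbump_bounded : exists2 M : R, 0 < M & forall s, `|dbump s| <= M.
Proof.
have [K K0 flatK] := @flat_quadratic R (dflat 1).
exists (K * 8) => [|s]; first exact: mulr_gt0.
have [s1|s1] := leP 1 `|s|; first by rewrite dbump_eq0// normr0 mulr_ge0// ltW.
have le4 t : - 2 <= t -> t <= 2 -> `|flat (dflat 1) t| <= K * 4.
  move=> t1 t2; rewrite (le_trans (flatK _))// ler_pM2l//.
  by rewrite -subr_ge0 (_ : _ - _ = (2 - t) * (2 + t)) ?mulr_ge0//; [lra|lra|ring].
move: s1; rewrite ltr_norml => /andP[s1 s2].
rewrite (le_trans (ler_normB _ _))// !normrM !(ger0_norm (flat1_ge0 _)).
rewrite (_ : K * 8 = 1 * (K * 4) + (K * 4) * 1); last by ring.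
by rewrite lerD// ler_pM ?flat1_ge0 ?flat1_le1// le4//; lra.
Qed.

End bump.

(** * A cylinder around a line *)
Section cylinder.
Context {R : realType} {n : nat}.
Local Notation mT := (measurableTypeR R).
Local Notation mu := (lebesgue_measure_tuple R n).
Variable xi : 'rV[R]_n.
Hypothesis xi_neq0 : xi != 0.
Implicit Types (x d : 'rV[R]_n) (t : R).

(** Normalized so that [axial (x + t *: xi) = axial x + t]. *)
Definition axis : 'rV[R]_n := (edot xi xi)^-1 *: xi.
Definition axial x : R := edot x axis.
(** The linear form giving the [i]-th coordinate of the component of [x] orthogonal
to [xi]. *)
Definition radial i : 'rV[R]_n := delta_mx 0 i - xi 0 i *: axis.
(** A bump in the directions orthogonal to [xi], invariant along [xi]. *)
Definition section_bump x : R := \prod_(i < n) bump (edot x (radial i)).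
(** The translates of [cell] by the integer multiples of [xi] tile [section_bump]:
they replace an integration along the axis, and only require the translation
invariance of the measure. *)
Definition cell x : R := \1_(`[0, 1[%classic) (axial x) * section_bump x.
Definition plateau (N : R) x : R := bump (axial x / N) * section_bump x.

Lemma axial_shift x t : axial (x + t *: xi) = axial x + t.
Proof.
by rewrite /axial edotDl edotZl /axis (edotZr _ _ xi) mulVf ?mulr1// edot_eq0.
Qed.

Lemma edot_radial x i : edot x (radial i) = x 0 i - xi 0 i * axial x.
Proof. by rewrite /radial -scaleNr edotDr edot_delta edotZr mulNr. Qed.

Lemma section_bump_shift x t : section_bump (x + t *: xi) = section_bump x.
Proof.
apply: eq_bigr => i _; congr bump.
by rewrite !edot_radial axial_shift !mxE; ring.
Qed.

Lemma section_bump_ge0 x : 0 <= section_bump x.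
Proof. by apply: prodr_ge0 => i _; exact: bump_ge0. Qed.

Lemma section_bump_le1 x : section_bump x <= 1.
Proof. by apply: prodr_ile1 => i _; rewrite bump_ge0 bump_le1. Qed.

Lemma section_bump_neq0 x : section_bump x != 0 ->
  forall i, `|x 0 i - xi 0 i * axial x| < 1.
Proof.
move=> /prodf_neq0 xi0 i; rewrite -edot_radial; apply: bump_neq0.
exact: xi0.
Qed.

Lemma Ck_bump k d : Ck k (fun x => bump (edot x d)).
Proof.
rewrite (_ : (fun x => _) = (fun x => flat 1 (edot x (- d) + 1)) \*
  (fun x => flat 1 (edot x d + 1))); first by apply: CkM; exact: Ck_flat.
apply/funext => x; have edotN : edot x (- d) = - edot x d.
  by rewrite -scaleN1r edotZr mulN1r.
by rewrite /bump /= edotN; congr (flat _ _ * flat _ _); rewrite addrC.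
Qed.

Lemma Ck_section_bump k : Ck k section_bump.
Proof. by apply: Ck_prod => i; exact: Ck_bump. Qed.

Lemma Ck_plateau k N : Ck k (plateau N).
Proof.
rewrite (_ : plateau N =
  (fun x => bump (edot x (N^-1 *: axis))) \* section_bump).
  by apply: CkM; [exact: Ck_bump|exact: Ck_section_bump].
by apply/funext => x; rewrite /plateau /= edotZr (mulrC N^-1).
Qed.

Lemma is_derive_plateau N x (c : R) :
  is_derive x (c *: xi) (plateau N)
    (c / N * dbump (axial x / N) * section_bump x).
Proof.
rewrite -[x in is_derive x]addr0 -(scale0r (c *: xi)); apply/is_derive_lineP.
rewrite (_ : (fun s : R => _) =
    (fun t : R => bump (axial x / N + (c / N) * t) * section_bump x)); last first.
  apply/funext => t; rewrite /plateau scalerA axial_shift section_bump_shift.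
  by congr (bump _ * _); ring.
pose g (t : R) := axial x / N + (c / N) * t.
have dg : is_derive (0 : R) 1 g (c / N).
  by apply: is_derive_eq; rewrite /GRing.scale/=; ring.
have db : is_derive (0 : R) 1 (bump \o g) (dbump (axial x / N) * (c / N)).
  apply: is_derive1_comp; rewrite /g mulr0 addr0; exact: is_derive_bump.
have := is_deriveM db (@is_derive_cst _ _ _ (section_bump x) (0 : R) 1).
by move/is_derive_eq; apply; rewrite /GRing.scale/= mulr0 add0r; ring.
Qed.

Lemma cell_axial x : cell x = (0 <= axial x < 1)%R%:R * section_bump x.
Proof.
by rewrite /cell indicE mem_setE in_itv.
Qed.

Lemma cell_shift x t :
  cell (x - t *: xi) = (t <= axial x < t + 1)%R%:R * section_bump x.
Proof.
rewrite -scaleNr cell_axial axial_shift section_bump_shift.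
by rewrite subr_ge0 ltrBlDr (addrC 1).
Qed.

Lemma cell_ge0 x : 0 <= cell x.
Proof. by rewrite cell_axial mulr_ge0 ?section_bump_ge0. Qed.

Lemma measurable_section_bump : measurable_rV section_bump.
Proof. exact: (continuous_measurable_rV (Ck_section_bump 0)). Qed.

Lemma continuous_axial : continuous axial.
Proof. exact: continuous_edot. Qed.

Lemma measurable_cell : measurable_rV cell.
Proof.
apply: measurable_funM; last exact: measurable_section_bump.
apply: (@measurableT_comp _ _ _ _ _ _ (\1_(`[0, 1[%classic) : R -> R)).
  by apply: measurable_indic; exact: measurable_itv.
exact: (continuous_measurable_rV continuous_axial).
Qed.

Lemma integral_rV_indic_box (q : 'rV[R]_n) (r : R) : 0 <= r ->
  (\int[mu]_t (\1_(box_tuple q r) t)%:E)%E = ((r *+ 2) ^+ n)%:E.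
Proof.
move=> r0; rewrite integral_indic//; last exact: measurable_box_tuple.
by rewrite setIT; exact: lebesgue_measure_box_tuple.
Qed.

Lemma integral_cell_fin : (integral_rV cell < +oo)%E.
Proof.
pose r := 1 + enorm xi + 1.
have r0 : 0 <= r by rewrite !addr_ge0 ?enorm_ge0.
apply: (@le_lt_trans _ _ (\int[mu]_t (\1_(box_tuple 0 r) t)%:E)%E).
  apply: ge0_le_integral => //.
  - by move=> t _; rewrite lee_fin cell_ge0.
  - by apply/measurable_EFinP; exact: measurable_cell.
  - apply/measurable_EFinP; apply: measurable_indic.
    exact: measurable_box_tuple.
  move=> t _; rewrite lee_fin indicE.
  have [->|cell0] := eqVneq (cell (tuple_rV t)) 0; first by [].
  rewrite mem_set.
    rewrite cell_axial mulr_ile1 ?section_bump_ge0 ?section_bump_le1//.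
    by case: (_ && _).
  move: cell0; rewrite cell_axial mulf_eq0 negb_or pnatr_eq0 eqb0 negbK.
  move=> /andP[/andP[s0 s1] /section_bump_neq0 tb] i.
  rewrite mxE subr0; have := tb i; rewrite mxE.
  have := coord_le_enorm xi i.
  have : `|xi 0 i * axial (tuple_rV t)| <= `|xi 0 i|.
    by rewrite normrM ler_piMr// ger0_norm// ltW.
  set y := xi 0 i * _; set z := tnth t i => yx xe zy.
  have := ler_normD (z - y) y; rewrite subrK /r; lra.
by rewrite integral_rV_indic_box// ltry.
Qed.

(** The point [2^-1 *: xi] lies on the axis, at the centre of the cell, so [cell] is
bounded from below on a box around it. *)
Lemma integral_cell_gt0 : (0 < integral_rV cell)%E.
Proof.
pose q := 2^-1 *: xi.
have axq : axial q = 2^-1.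
  by have := axial_shift 0 2^-1; rewrite add0r => ->; rewrite /axial edotC edot0r add0r.
have bumpq : 0 < section_bump q.
  apply: prodr_gt0 => i _; rewrite edot_radial axq mxE mulrC subrr.
  by rewrite /bump subr0 addr0 mulr_gt0// flat1_gt0 ?expR_gt0.
pose c := section_bump q / 2.
have c0 : 0 < c by rewrite divr_gt0.
have [e e0 qe] : exists2 e : R, 0 < e & forall x, ball q e x -> c <= cell x.
  have near_q : \forall x \near q, c <= cell x.
    near=> x; rewrite cell_axial.
    have -> : (0 <= axial x < 1)%R.
      apply/andP; split; [apply/ltW|]; near: x.
        by move/cvgr_gt: (@continuous_axial q); apply; rewrite axq.
      by move/cvgr_lt: (@continuous_axial q); apply; rewrite axq invf_lt1// ltr1n.
    rewrite mul1r; apply/ltW; near: x.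
    have cs : continuous section_bump := Ck_section_bump 0.
    move/cvgr_gt: (cs q); apply.
    by rewrite ltr_pdivrMr// ltr_pMr// ltr1n.
  by have /nbhs_ballP[e /= e0 qe] := near_q; exists e.
have mbox : measurable_fun setT 
    (fun z : n.-tuple mT => (\1_(box_tuple q e) z)%:E : \bar R).
  by apply/measurable_EFinP; apply: measurable_indic; exact: measurable_box_tuple.
apply: (@lt_le_trans _ _ (\int[mu]_t (c%:E * (\1_(box_tuple q e) t)%:E))%E).
  rewrite (ge0_integralZl _ measurableT mbox)/=; last 2 first.
  - by move=> t _; rewrite lee_fin indicE.
  - by rewrite lee_fin ltW.
  rewrite integral_rV_indic_box ?ltW// -EFinM lte_fin mulr_gt0// exprn_gt0//.
  by rewrite mulrn_wgt0.
apply: ge0_le_integral => //.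
- by move=> t _; rewrite -EFinM lee_fin mulr_ge0 ?(ltW c0)// indicE.
- exact: (measurable_funeM c%:E mbox).
- by apply/measurable_EFinP; exact: measurable_cell.
move=> t _; rewrite -EFinM lee_fin indicE.
case: (boolP (t \in _)) => [|_]; last by rewrite mulr0 cell_ge0.
rewrite inE mulr1 => qt; apply: qe; split => // i j.
by rewrite (ord1 i) /ball/= distrC [tuple_rV _ _ _]mxE; exact: qt.
Unshelve. all: by end_near. Qed.

(** [dbump] vanishes outside of [`]-1, 1[], so only the points with
[`|axial x| < N] matter; each of them lies in one of the [N + N] cells. *)
Lemma dbump_le_cells (M : R) (N : nat) x : (0 < N)%N ->
  (forall s : R, `|dbump s| <= M) ->
  `|dbump (axial x / N%:R)| * section_bump x <=
  M * \sum_(j < N + N) cell (x - (j%:R - N%:R) *: xi).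
Proof.
move=> N0 dM; have N0' : 0 < N%:R :> R by rewrite ltr0n.
have M0 : 0 <= M by exact: le_trans (dM 0).
have [s1|s1] := leP 1 `|axial x / N%:R|.
  by rewrite dbump_eq0// normr0 mul0r mulr_ge0// sumr_ge0// => j _; exact: cell_ge0.
move: s1; rewrite normrM (ger0_norm (_ : 0 <= N%:R^-1)) ?invr_ge0//.
rewrite ltr_pdivrMr// mul1r ltr_norml => /andP[s1 s2].
have s0 : 0 <= axial x + N%:R by lra.
have /andP[j1 j2] := truncn_itv s0.
set j := Num.truncn _ in j1 j2.
have jN : (j < N + N)%N by rewrite -(ltr_nat R) natrD; lra.
rewrite ler_pM ?section_bump_ge0//.
rewrite (bigD1 (Ordinal jN))//= cell_shift.
have -> : (j%:R - N%:R <= axial x < j%:R - N%:R + 1)%R.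
  by move: j2; rewrite -natr1 => j2; apply/andP; split; lra.
by rewrite mul1r lerDl sumr_ge0// => k _; exact: cell_ge0.
Qed.

Lemma integral_cells (m : nat) (w : 'I_m -> R) (t : 'I_m -> R) :
  (forall j, 0 <= w j) ->
  integral_rV (fun x => \sum_(j < m) w j * cell (x - t j *: xi)) =
  ((\sum_(j < m) w j)%:E * integral_rV cell)%E.
Proof.
move=> w0; have mcell j : measurable_rV (fun x => cell (x - t j *: xi)).
  exact: measurable_rV_shift measurable_cell.
rewrite integral_rV_sum => [|j|j x].
- rewrite -sumEFin ge0_sume_distrl => [|j _]; last by rewrite lee_fin.
  apply: eq_bigr => j _; rewrite integral_rVZl//; last first.
    by move=> x; exact: cell_ge0.
  rewrite (integral_rV_shift (- (t j *: xi)) measurable_cell)// => x.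
  exact: cell_ge0.
- by apply: measurable_funM => //; exact: mcell.
- by rewrite mulr_ge0 ?cell_ge0.
Qed.

(** At most one term of the sum is nonzero. In the cell of index [k.+1], the norm of
[x] is at most a fixed multiple of [k.+1], and the longitudinal factor [bump] of the
plateau is at least [exp (- 4)], because [axial x] is at most half of its length. The cell that touches the origin is left
out of the sum, because the quotient on the right is 0 at the origin. *)
Lemma cells_le_plateau (K : nat) x :
  \sum_(k < K) k.+1%:R^-1 * cell (x - k.+1%:R *: xi) <=
  expR 4 * (n.+1%:R * (1 + 2 * enorm xi)) *
    (plateau (K.+1 + K.+1)%:R x / enorm x).
Proof.
have e0 : 0 <= enorm xi := enorm_ge0 xi.
have [[k /andP[k1 k2]]|nok] :=
    pselect (exists k : 'I_K, k.+1%:R <= axial x < k.+1%:R + 1); last first.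
  rewrite big1 => [|k _].
    rewrite mulr_ge0//; last first.
      by rewrite divr_ge0 ?enorm_ge0// mulr_ge0 ?bump_ge0 ?section_bump_ge0.
    by rewrite !mulr_ge0 ?expR_ge0// addr_ge0// mulr_ge0.
  rewrite cell_shift (_ : (_ <= _ < _) = false) ?mul0r ?mulr0//.
  by apply/negP => kx; apply: nok; exists k.
rewrite (bigD1 k)//= [X in _ + X]big1 ?addr0 => [|j jk]; last first.
  rewrite cell_shift (_ : (_ <= _ < _) = false) ?mul0r ?mulr0//.
  apply/negP => /andP[j1 j2]; move/eqP: jk; apply; apply/val_inj/eqP => /=.
  have jk : j.+1%:R < k.+2%:R :> R by rewrite -[in ltRHS]natr1; lra.
  have kj : k.+1%:R < j.+2%:R :> R by rewrite -[in ltRHS]natr1; lra.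
  by move: jk kj; rewrite !ltr_nat !ltnS eqn_leq => -> ->.
rewrite cell_shift k1 k2 mul1r /plateau.
have [->|sx] := eqVneq (section_bump x) 0; first by rewrite !(mulr0, mul0r).
set Q := n.+1%:R * _.
have k0 : 1 <= k.+1%:R :> R by rewrite ler1n.
have s0 : 0 < axial x by rewrite (lt_le_trans _ k1)// (lt_le_trans _ k0).
have xk : enorm x <= Q * k.+1%:R.
  apply: (@le_trans _ _ (n%:R * ((1 + 2 * enorm xi) * k.+1%:R))).
    apply: enorm_le_coord => [|i]; first by rewrite !mulr_ge0// addr_ge0// mulr_ge0.
    have := section_bump_neq0 sx i; have := coord_le_enorm xi i.
    set y := x 0 i; set z := xi 0 i => ze yz.
    have zs : `|z * axial x| <= enorm xi * (2 * k.+1%:R).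
      by rewrite normrM ler_pM// gtr0_norm//; lra.
    have := ler_normD (y - z * axial x) (z * axial x); rewrite subrK => yt.
    rewrite (_ : _ * k.+1%:R = k.+1%:R + enorm xi * (2 * k.+1%:R)); last by ring.
    by rewrite (le_trans yt)// lerD// (le_trans (ltW yz))//.
  by rewrite mulrA ler_wpM2r// ler_wpM2r ?addr_ge0 ?mulr_ge0// ler_nat.
have x0 : 0 < enorm x.
  rewrite enorm_gt0; apply: contraTneq s0 => ->.
  by rewrite /axial edotC edot0r ltxx.
have bump4 : 1 <= expR 4 * bump (axial x / (K.+1 + K.+1)%:R).
  rewrite -ler_pdivrMl ?expR_gt0// mulr1 -expRN; apply: bump_ge_half.
  have K0 : 0 < (K.+1 + K.+1)%:R :> R by rewrite ltr0n.
  rewrite ger0_norm; last by rewrite divr_ge0 ?ltW.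
  have kK : k.+1%:R <= K%:R :> R by rewrite ler_nat.
  rewrite ler_pdivrMr// natrD -[K.+1%:R]natr1; lra.
set B := bump _; rewrite (_ : _ * _ = expR 4 * B * (Q / enorm x * section_bump x)).
  rewrite -[leLHS]mul1r ler_pM ?mulr_ge0 ?invr_ge0 ?section_bump_ge0//.
  rewrite ler_wpM2r ?section_bump_ge0// ler_pdivlMr// mulrC ler_pdivrMr//.
ring.
Qed.

Lemma plateau_compact_support (N : R) : 0 < N ->
  compact (closure [set x | plateau N x != 0]).
Proof.
move=> N0; pose r := 1 + enorm xi * N.
have r0 : 0 <= r by rewrite addr_ge0// mulr_ge0 ?enorm_ge0// ltW.
pose A := [set x : 'rV[R]_n | `|x| <= r].
have cA : closed A.
  rewrite (_ : A = (fun x : 'rV[R]_n => `|x|) @^-1` [set y | y <= r])//.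
  apply: preimage_closed; last exact: closed_le.
  by move=> x _; exact: norm_continuous.
apply: (@subclosed_compact _ _ A); first exact: closed_closure.
  apply: bounded_closed_compact => //; exists r; split; first exact: num_real.
  by move=> M rM x /= xr; rewrite (le_trans xr)// ltW.
have cAE : closure A = A by apply/esym/closure_id.
rewrite -cAE; apply: closureS => x /=.
rewrite mulf_eq0 negb_or => /andP[/bump_neq0 sN /section_bump_neq0 sx].
apply: rV_norm_le => // i; have := sx i; have := coord_le_enorm xi i.
set z := xi 0 i => ze yz.
have sN' : `|axial x| <= N.
  move: sN; rewrite normrM normfV (gtr0_norm N0) ltr_pdivrMr// mul1r; exact: ltW.
have zs : `|z * axial x| <= enorm xi * N by rewrite normrM ler_pM.
rewrite -[x 0 i](subrK (z * axial x)) (le_trans (ler_normD _ _))// lerD//.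
exact: ltW.
Qed.

End cylinder.

(** * From the Hardy inequality to the algebraic condition *)
Lemma harmonic_unbounded (R : realType) (B : R) :
  exists K : nat, B < \sum_(k < K) k.+1%:R^-1.
Proof.
apply/not_existsP => bnd; apply: (@dvg_harmonic R).
apply: nondecreasing_is_cvgn.
  by apply: nondecreasing_series => k _ _; rewrite invr_ge0.
exists B => _ [K _ <-]; rewrite leNgt; apply/negP => BK; apply: (bnd K).
by rewrite /series/= big_mkord in BK.
Qed.

Section necessity.
Context {R : realType} {V : normedVectType R} {dot : {dot V for idfun}}.
Hypothesis norm_dot : forall v : V, `|v| = Num.sqrt (dot v v).
Context {n l : nat} (a : 'I_l -> V) (b : 'I_l -> 'rV[R]_n).
Hypothesis b_neq0 : forall i, b i != 0.

Lemma parallel_scale (x d : 'rV[R]_n) : x != 0 -> d != 0 ->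
  enorm d ^+ 2 *: x = edot x d *: d -> exists c : R, d = c *: x.
Proof.
move=> x0 d0 xd.
have xd0 : edot x d != 0.
  apply: contra_neq x0 => E; move: xd; rewrite E scale0r => /eqP.
  by rewrite scaler_eq0 expf_eq0/= enorm_eq0 (negPf d0) => /eqP.
exists (enorm d ^+ 2 / edot x d); rewrite mulrC -scalerA xd scalerA.
by rewrite mulVf// scale1r.
Qed.

Section test_functions.
Variables (xi : 'rV[R]_n) (v : V).
Hypotheses (xi_neq0 : xi != 0) (v_neq0 : v != 0).
Hypothesis degenerate : forall i, dot (a i) v = 0 \/
  enorm (b i) ^+ 2 *: xi = edot xi (b i) *: b i.

Let u (N : R) x := plateau xi N x *: v.

Lemma test_smooth N : 0 < N -> smooth_compact_support (u N).
Proof.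
move=> N0; split => [k|]; first by apply: CkZv; exact: Ck_plateau.
rewrite (_ : [set x | _] = [set x | plateau xi N x != 0]).
  exact: plateau_compact_support.
by apply/funext => x; rewrite /= scaler_eq0 (negPf v_neq0) orbF.
Qed.

(** Either the factor [dot (a i) v] vanishes, or [b i] is parallel to [xi] and the
derivative does not see [section_bump]. *)
Lemma test_derive i : exists2 c : R, 0 <= c & forall N x, 0 < N ->
  `|dot (a i) ('D_(b i) (u N) x)| =
  c / N * (`|dbump (axial xi x / N)| * section_bump xi x).
Proof.
have dplateau N x d : derivable (plateau xi N) x d.
  by have [_ /(_ d)[]] := Ck_plateau xi 1 N.
have Du N x : 'D_(b i) (u N) x = 'D_(b i) (plateau xi N) x *: v.
  have dN := is_deriveZv v (dplateau N x (b i)).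
  exact: derive_val.
have [dot0|/parallel_scale[]//] := degenerate i.
  by exists 0 => // N x _; rewrite Du linearZ /= dot0 mulr0 normr0 !mul0r.
move=> k bk; exists (`|k| * `|dot (a i) v|) => [|N x N0]; first exact: mulr_ge0.
rewrite Du linearZ /= bk.
have dN := is_derive_plateau xi_neq0 N x k.
rewrite derive_val !normrM normfV (gtr0_norm N0).
by rewrite (ger0_norm (section_bump_ge0 xi x)); ring.
Qed.

(** The bound is uniform in [N]: the factor [N^-1] of the derivative compensates for
the number [N + N] of cells. *)
Lemma test_integral_le i : exists B : R, forall N : nat, (0 < N)%N ->
  (integral_rV (fun x => `|dot (a i) ('D_(b i) (u N%:R) x)|%R)
    <= B%:E * integral_rV (cell xi))%E.
Proof.
have [c c0 Dc] := test_derive i; have [M M0 dM] := @dbump_bounded R.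
exists (c * M *+ 2) => N N0; have N0' : 0 < N%:R :> R by rewrite ltr0n.
pose t (j : 'I_(N + N)) : R := j%:R - N%:R.
have -> : c * M *+ 2 = \sum_(j < N + N) c / N%:R * M.
  rewrite sumr_const card_ord -[RHS]mulr_natr natrD mulr2n.
  by field; rewrite gt_eqF.
rewrite -(integral_cells xi t) => [|j]; last first.
  by rewrite !mulr_ge0 ?invr_ge0// ltW.
have Cu : Ck 1 (u N%:R) by have [Cu _] := test_smooth N0'.
have cD : continuous (fun x => `|dot (a i) ('D_(b i) (u N%:R) x)|).
  have [_ /(_ (b i))[_ cD]] := Cu.
  move=> x; apply: (@continuous_comp _ _ _ (fun x => 'D_(b i) (u N%:R) x)
    (fun w => `|dot (a i) w|)); first exact: cD.
  apply: continuous_comp; first exact: continuous_dot.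
  exact: norm_continuous.
apply: le_integral_rV => //.
- exact: continuous_measurable_rV.
- apply: (@measurable_rV_sum _ _ _ _
    (fun j x => c / N%:R * M * cell xi (x - t j *: xi))) => j.
  apply: measurable_funM => //.
  exact: (@measurable_rV_shift _ _ (cell xi) _ (@measurable_cell _ _ xi)).
move=> x; rewrite Dc// -mulr_sumr -[leRHS]mulrA ler_wpM2l ?divr_ge0 ?(ltW N0')//.
by rewrite dbump_le_cells.
Qed.

Lemma test_integral_ge : exists2 B : R, 0 < B & forall K : nat,
  ((\sum_(k < K) k.+1%:R^-1)%:E * integral_rV (cell xi)
    <= B%:E * integral_rV
         (fun x => `|u (K.+1 + K.+1)%:R x| / enorm x)%R)%E.
Proof.
pose D : R := expR 4 * (n.+1%:R * (1 + 2 * enorm xi)).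
have D0 : 0 < D.
  by rewrite !mulr_gt0 ?expR_gt0 ?ltr0n// ltr_pwDl// mulr_ge0 ?enorm_ge0.
have nv0 : 0 < `|v| by rewrite normr_gt0.
exists (D / `|v|) => [|K]; first by rewrite divr_gt0.
pose t (k : 'I_K) : R := k.+1%:R.
rewrite -(integral_cells xi t) => [|k]; last by rewrite invr_ge0.
set N : R := (K.+1 + K.+1)%:R.
have cp : continuous (plateau xi N) := Ck_plateau xi 0 N.
have p0 x : 0 <= plateau xi N x.
  by rewrite mulr_ge0 ?bump_ge0 ?section_bump_ge0.
have uE x : `|u N x| = plateau xi N x * `|v| by rewrite normrZ ger0_norm.
have mquot : measurable_rV (fun x => `|u N x| / enorm x).
  apply: measurable_funM.
    rewrite (_ : (fun _ => _) = fun z => plateau xi N (tuple_rV z) * `|v|).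
      by apply: measurable_funM => //; exact: (continuous_measurable_rV cp).
    by apply/funext => z; rewrite uE.
  apply: (@measurable_rV_inv _ _ (@enorm R n)); last exact: enorm_ge0.
  exact: (continuous_measurable_rV (@continuous_enorm R n)).
rewrite -integral_rVZl//; last 2 first.
- by move=> x; rewrite divr_ge0 ?enorm_ge0.
- by rewrite divr_ge0 ?ltW.
apply: le_integral_rV => //.
- apply: (@measurable_rV_sum _ _ _ _
    (fun (k : 'I_K) x => k.+1%:R^-1 * cell xi (x - t k *: xi))) => k.
  apply: measurable_funM => //.
  exact: (@measurable_rV_shift _ _ (cell xi) _ (@measurable_cell _ _ xi)).
- exact: measurable_funM.
- by move=> x; apply: sumr_ge0 => k _; rewrite mulr_ge0 ?cell_ge0.
move=> x; rewrite (le_trans (cells_le_plateau xi_neq0 K x))//.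
rewrite -/D -/N uE le_eqVlt; apply/orP; left; apply/eqP.
by move: (enorm x)^-1 => y; field; rewrite gt_eqF.
Qed.

(** After division by the integral of [cell], the inequality would bound all the
partial sums of the harmonic series. *)
Lemma hardy_degenerate (C : R) : 0 < C ->
  ~ (forall u : 'rV[R]_n -> V, smooth_compact_support u ->
    (integral_rV (fun x => (`|u x| / enorm x)%R)
      <= C%:E *
         \sum_(i < l) integral_rV (fun x => `|dot (a i) ('D_(b i) u x)|%R))%E).
Proof.
move=> C0 hardy.
have [B BP] := choice test_integral_le; have [D D0 DP] := test_integral_ge.
have [K] := harmonic_unbounded (D * (C * \sum_(i < l) B i)).
apply/negP; rewrite -leNgt -lee_fin.
have I0 := integral_cell_gt0 xi_neq0.
have IE : integral_rV (cell xi) = (fine (integral_rV (cell xi)))%:E.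
  by rewrite fineK// gt0_fin_numE// integral_cell_fin.
rewrite -(@lee_pmul2r _ (integral_rV (cell xi)))//; last by rewrite IE.
apply: le_trans (DP K) _; rewrite EFinM -muleA lee_pmul2l//.
have N0 : 0 < (K.+1 + K.+1)%:R :> R by rewrite ltr0n.
apply: le_trans (hardy _ (test_smooth N0)) _; rewrite EFinM -muleA lee_pmul2l//.
apply: (@le_trans _ _ (\sum_(i < l) (B i)%:E * integral_rV (cell xi))%E).
  by apply: lee_sum => i _; exact: BP.
rewrite IE -EFinM mulr_suml -sumEFin le_eqVlt; apply/orP; left; apply/eqP.
by apply: eq_bigr => i _; rewrite EFinM.
Qed.

End test_functions.

Lemma hardy_necessary (C : R) : 0 < C ->
  (forall u : 'rV[R]_n -> V, smooth_compact_support u ->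
    (integral_rV (fun x => (`|u x| / enorm x)%R)
      <= C%:E *
         \sum_(i < l) integral_rV (fun x => `|dot (a i) ('D_(b i) u x)|%R))%E) ->
  forall (xi : 'rV[R]_n) (v : V), xi != 0 -> v != 0 ->
  exists i : 'I_l,
    dot (a i) v != 0 /\ (enorm (b i)) ^+ 2 *: xi != edot xi (b i) *: b i.
Proof.
move=> C0 hardy xi v xi0 v0; apply: contrapT => /forallNP none.
apply: (hardy_degenerate xi0 v0 _ C0 hardy) => i.
have [->|dot0] := eqVneq (dot (a i) v) 0; first by left.
have [->|par] := eqVneq (enorm (b i) ^+ 2 *: xi) (edot xi (b i) *: b i).
  by right.
by exfalso; apply: (none i); split.
Qed.

End necessity.

Theorem proposition5p1 (R : realType) (V : normedVectType R)
    (dot : {dot V for idfun})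
    (norm_dot : forall v : V, `|v| = Num.sqrt (dot v v))
    (n l : nat) (l_gt0 : (0 < l)%N)
    (a : 'I_l -> V) (b : 'I_l -> 'rV[R]_n)
    (a_neq0 : forall i, a i != 0) (b_neq0 : forall i, b i != 0) :
  (exists2 C : R, 0 < C &
     forall u : 'rV[R]_n -> V, smooth_compact_support u ->
       (integral_rV (fun x => (`|u x| / enorm x)%R)
        <= C%:E *
           \sum_(i < l) integral_rV (fun x => `|dot (a i) ('D_(b i) u x)|%R))%E)
  <->
  (forall (xi : 'rV[R]_n) (v : V), xi != 0 -> v != 0 ->
     exists i : 'I_l,
       dot (a i) v != 0 /\ (enorm (b i)) ^+ 2 *: xi != edot xi (b i) *: b i).
Proof.
have i0 : 'I_l by exact: Ordinal l_gt0.
split=> [[C C0 hardy]|spanning]; first exact: hardy_necessary hardy.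
have [|C C0 coer] := coercive spanning b_neq0 (ex_intro _ (b i0) (b_neq0 i0)).
  by exists (a i0).
exists (C^-1 * pi); first by rewrite mulr_gt0 ?invr_gt0 ?pi_gt0.
by move=> u su; apply: hardy_sufficient su.
Qed.
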